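(* Let $N,L\in\mathbb N$, $d\in\{2,3,4\}$, $a\in(0,1]$, $g^2\in(0,g_0^2]$ with $0<g_0<\infty$, and $C^2=4N$. Let $Z_{\Lambda,a}$ and $Z^P_{\Lambda,a}$ be the $\mathrm U(N)$ Wilson lattice Yang–Mills partition functions with free and periodic boundary conditions, respectively. Define $$z_u=\int_{\mathrm U(N)}\exp\left[-2\,\frac{a^{d-4}}{g^2}\,\mathrm{Re}\,\mathrm{Tr}(1-U)\right]d\sigma(U),\qquad z_\ell=\int_{\mathrm U(N)}\exp\left[-2C^2\,\frac{a^{d-4}}{g^2}\,(d-1)\,\mathrm{Tr}\,X^2\right]d\sigma(U),$$ where in $z_\ell$ one writes $U=e^{iX}$ with $X$ self-adjoint with eigenvalues in $(-\pi,\pi]$. Then: Free boundary conditions: $$z_\ell^{\Lambda_r}\;\le\; Z_{\Lambda,a}\;\le\; z_u^{\Lambda_r}.$$ Periodic boundary conditions: $$z_\ell^{\Lambda_r+\Lambda_e}\;\le\; Z^P_{\Lambda,a}\;\le\; Z_{\Lambda,a}\;\le\; z_u^{\Lambda_r}.$$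
   Context: Lattice. $\Lambda\subset a\mathbb Z^d$ is a finite hypercubic lattice with $L$ sites on each side, coordinates $x^\mu$, $\mu=0,\dots,d-1$, labelled $1,\dots,L$; $e^\mu$ is the unit vector in direction $\mu$. Free bonds: $b_\mu(x)$ from $x\in\Lambda$ to $x+ae^\mu\in\Lambda$. Periodic bonds: the free bonds plus, in each coordinate direction $\mu$, the extra bonds from each site with $x^\mu=L$ to the site with $x^\mu=1$ (other coordinates equal). Free plaquettes: $p_{\mu\nu}(x)$, $\mu<\nu$, with vertices $x,x+ae^\mu,x+ae^\mu+ae^\nu,x+ae^\nu\in\Lambda$. Periodic plaquettes: all plaquettes $p_{\mu\nu}(x)$, $x\in\Lambda$, $\mu<\nu$, formed from periodic bonds (addition understood periodically). Model. Each bond $b$ carries a variable $U_b\in\mathrm U(N)$. For $p=p_{\mu\nu}(x)$, $U_p=U_{b_\mu(x)}U_{b_\nu(x+ae^\mu)}U_{b_\mu(x+ae^\nu)}^{\dagger}U_{b_\nu(x)}^{\dagger}$ and $A_p=\mathrm{Tr}[(U_p-1)^\dagger(U_p-1)]=2\,\mathrm{Re}\,\mathrm{Tr}(1-U_p)$. With $A^B=\sum_pA_p$ (sum over free plaquettes for $B$ blank, periodic plaquettes for $B=P$), $$Z^B_{\Lambda,a}=\int\exp\left[-\frac{a^{d-4}}{g^2}A^B\right]dg^B,$$ where $dg^B$ is the product over all bonds (free, respectively periodic) of the normalized Haar measure $d\sigma$ on $\mathrm U(N)$. Numbers. $\Lambda_e=dL^{d-1}$ is the number of extra bonds. $\Lambda_r$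 (the number of bond variables left, for free boundary conditions, after gauge fixing along a maximal tree) equals $(L-1)^2$ for $d=2$, $(2L+1)(L-1)^2$ for $d=3$, and $(3L^3-L^2-L-1)(L-1)$ for $d=4$. *)

(* Defs.v *)
From HB Require Import structures.
From mathcomp Require Import all_boot all_order all_algebra.
From mathcomp Require Import complex.
From mathcomp Require Import all_classical all_reals all_analysis.

Set Implicit Arguments.
Unset Strict Implicit.
Unset Printing Implicit Defensive.

Import Order.TTheory GRing.Theory Num.Theory.
Import numFieldNormedType.Exports.

Local Open Scope classical_set_scope.
Local Open Scope ring_scope.
Local Open Scope sesquilinear_scope.

(* The libraries put no topology on R[i]; this is the one of the modulus, and
   it induces the product topology on matrices. *)
#[non_forgetful_inheritance]
HB.instance Definition _ (R : rcfType) := NormedModule.copy R[i] R[i]^o.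

Section unitary_group.
Variables (R : realType) (N : nat).

Definition unitary : Type := [set U : 'M[R[i]]_N | U \is unitarymx].

HB.instance Definition _ := Topological.on unitary.

Lemma unitarymx1 : (1%:M : 'M[R[i]]_N) \is unitarymx.
Proof. by apply/unitarymxP; rewrite trmx1 map_mx1 mulmx1. Qed.

Definition unitary1 : unitary :=
  exist _ 1%:M (mem_set (unitarymx1 : [set U | U \is unitarymx] 1%:M)).

HB.instance Definition _ := isPointed.Build unitary unitary1.

Definition unitaryM (U V : unitary) : unitary :=
  exist _ (\val U *m \val V)
    (mem_set (mul_unitarymx (set_mem (valP U)) (set_mem (valP V)))).

(* U(N) with its Borel sigma-algebra. *)
Definition borelU := g_sigma_algebraType (@open unitary).

End unitary_group.

(* Left invariance characterises the normalized Haar measure: U(N) is compact. *)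
Definition is_haar (R : realType) (N : nat)
    (sigma : probability (borelU R N) R) : Prop :=
  forall (U : unitary R N) (A : set (borelU R N)),
    measurable A -> sigma [set unitaryM U V | V in A] = sigma A.

Section product_probability.
Context {d1 d2 : measure_display} {T1 : measurableType d1}
  {T2 : measurableType d2} {R : realType}.
Variables (P : probability T1 R) (Q : probability T2 R).

Definition product_probability : set (T1 * T2) -> \bar R := (P \x Q)%E.

HB.instance Definition _ := Measure.on product_probability.

Let product_probabilityT : product_probability setT = 1%E.
Proof.
transitivity (P setT * Q setT)%E; last by rewrite !probability_setT mule1.
by rewrite -product_measure1E// setXTT.
Qed.

HB.instance Definition _ :=
  Measure_isProbability.Build _ _ _ product_probability product_probabilityT.

End product_probability.

Section tcons.
Context {d : measure_display} {T : measurableType d} {n : nat}.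

Definition tcons (p : T * n.-tuple T) : n.+1.-tuple T :=
  [the n.+1.-tuple T of p.1 :: p.2].

Let measurable_tcons : measurable_fun [set: T * n.-tuple T] tcons.
Proof. exact: measurable_cons. Qed.

HB.instance Definition _ := isMeasurableFun.Build _ _ _ _ tcons measurable_tcons.

End tcons.

(* The n-fold product measure P x ... x P on n-tuples: the image of
   P x (P x (... x P)) under the identification (x, t) |-> x :: t. *)
Fixpoint power_probability (d : measure_display) (T : measurableType d)
    (R : realType) (P : probability T R) (n : nat) :
    probability (n.-tuple T) R :=
  match n with
  | 0 => \d_([tuple] : 0.-tuple T)
  | n'.+1 => distribution (product_probability P (power_probability P n')) tcons
  end.

Section lattice.
Variables d L : nat.

(* The coordinates x^mu, shifted by 1: the labels 1, ..., L become
   0, ..., L - 1. The spacing a only enters the model through the coupling. *)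
Definition site := {ffun 'I_d -> 'I_L}.

(* x + a e^mu, understood periodically *)
Definition shift (x : site) (mu : 'I_d) : site :=
  [ffun k => if k == mu then ordS (x k) else x k].

(* x + a e^mu belongs to the lattice, without the periodic identification *)
Definition has_succ (x : site) (mu : 'I_d) : bool := ((x mu).+1 < L)%N.

Inductive boundary := Free | Periodic.

(* (x, mu) stands for b_mu(x), and is an extra bond when ~~ has_succ x mu. *)
Definition is_bond (B : boundary) (b : site * 'I_d) : bool :=
  if B is Free then has_succ b.1 b.2 else true.

Definition bond (B : boundary) := {b : site * 'I_d | is_bond B b}.

(* (x, mu, nu) stands for p_{mu nu}(x). *)
Definition is_plaquette (B : boundary) (p : site * 'I_d * 'I_d) : bool :=
  let: (x, mu, nu) := p in
  (mu < nu)%N && (if B is Free then has_succ x mu && has_succ x nu else true).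

Definition extra_bonds : nat := (d * L ^ d.-1)%N.

(* For free boundary conditions, the d L^(d-1) (L - 1) bonds minus the L^d - 1
   bonds of a maximal tree; the subtractions are exact for 0 < L. *)
Definition retained_bonds : nat :=
  match d with
  | 2 => (L - 1) ^ 2
  | 3 => (2 * L + 1) * (L - 1) ^ 2
  | 4 => (3 * L ^ 3 - L ^ 2 - L - 1) * (L - 1)
  | _ => 0
  end%N.

End lattice.

Section model.
Variables (R : realType) (N d L : nat).

(* A bond configuration is a tuple indexed through the enumeration of the
   bonds, so as to carry the product sigma-algebra. *)
Definition config (B : boundary) := #|{: bond d L B}|.-tuple (borelU R N).

(* The value 1 outside the bonds of B is never used by a plaquette of B. *)
Definition bond_var (B : boundary) (U : config B) (b : site d L * 'I_d) :
    'M[R[i]]_N :=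
  if insub b is Some c then
    \val (tnth U (enum_rank (c : bond d L B)) : unitary R N)
  else 1%:M.

Definition plaquette_var (B : boundary) (U : config B)
    (p : site d L * 'I_d * 'I_d) : 'M[R[i]]_N :=
  let: (x, mu, nu) := p in
  bond_var U (x, mu) *m bond_var U (shift x mu, nu)
  *m (bond_var U (shift x nu, mu))^t* *m (bond_var U (x, nu))^t*.

Definition plaquette_action (B : boundary) (U : config B)
    (p : site d L * 'I_d * 'I_d) : R :=
  complex.Re (\tr ((plaquette_var U p - 1%:M)^t* *m (plaquette_var U p - 1%:M))).

Definition action (B : boundary) (U : config B) : R :=
  \sum_(p : site d L * 'I_d * 'I_d | is_plaquette B p) plaquette_action U p.

Variable sigma : probability (borelU R N) R.

Definition coupling (a g : R) : R := a ^ (d%:Z - 4%:Z) / g ^+ 2.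

Definition partition_function (B : boundary) (a g : R) : \bar R :=
  (\int[power_probability sigma #|{: bond d L B}|]_(U in [set: config B])
    (expR (- (coupling a g * action U)))%:E)%E.

End model.

Section single_bond.
Variables (R : realType) (N d : nat) (sigma : probability (borelU R N) R).

Definition expmx (A : 'M[R[i]]_N) : 'M[R[i]]_N :=
  limn (series (fun k : nat => k`!%:R^-1 *: A ^+ k)).

(* The order of R[i] compares only numbers with the same imaginary part, so
   that the bounds also say that the eigenvalue is real. *)
Definition is_log (U X : 'M[R[i]]_N) : Prop :=
  [/\ X \is hermsymmx,
      forall z : R[i], eigenvalue X z -> - (pi%:C)%C < z <= (pi%:C)%C
    & expmx ('i *: X) = U].

(* By the spectral theorem such an X exists and is unique. *)
Definition log_unitary (U : unitary R N) : 'M[R[i]]_N :=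
  xget 0 [set X | is_log (\val U) X].

Definition z_upper (a g : R) : \bar R :=
  (\int[sigma]_(U in [set: borelU R N])
    (expR (- (2 * coupling d a g *
      complex.Re (\tr (1%:M - \val (U : unitary R N))))))%:E)%E.

Definition z_lower (C a g : R) : \bar R :=
  (\int[sigma]_(U in [set: borelU R N])
    (expR (- (2 * C ^+ 2 * coupling d a g * (d%:R - 1) *
      complex.Re (\tr (log_unitary U *m log_unitary U)))))%:E)%E.

End single_bond.

(* Main.v *)
(* The weight [expR (- k Re tr (1 - U))] of a plaquette is a class function and
   equals [expR (- k |U - 1|^2 / 2)] in the Hilbert-Schmidt norm. Bonds are
   integrated out one at a time: a weight evaluated at [A U_b B] with A, B
   independent of U_b contributes the factor [boltzmann_integral k].

   Upper bound: take the comb tree made of the bonds b_mu(x) with x^k = 0 for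
   k < mu. To a bond b_mu(x) outside the tree attach the plaquette
   p_{nu mu}(x - e^nu), nu being the first direction with x^nu <> 0. These
   plaquettes are distinct and, for the lexicographic order on (mu, height of x),
   each has its own bond as strict maximum; the other plaquettes have weight at
   most 1.

   Lower bound: after the gauge transformation along the tree, the tree bonds
   become 1 and every other U_b becomes [G U_b H] with G, H functions of the tree
   bonds. Telescoping gives A_p <= 4 sum_(b in p) |U_b - 1|^2, and each bond lies
   in 2 (d - 1) plaquettes; the spectral theorem gives |U - 1|^2 <= tr X^2.

   Periodic versus free: the extra plaquettes have weight at most 1 and the extra
   bonds integrate to 1. *)
From mathcomp Require Import all_boot all_order all_algebra.
From mathcomp Require Import complex.
From mathcomp Require Import all_classical all_reals all_analysis.
From mathcomp Require Import measurable_realfun.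
From mathcomp Require Import ring lra zify.
Require Import Defs.
Set Implicit Arguments.
Unset Strict Implicit.
Unset Printing Implicit Defensive.
Import Order.TTheory GRing.Theory Num.Theory.
Import numFieldNormedType.Exports.
Local Open Scope ring_scope.
Local Open Scope sesquilinear_scope.

(** * Product probabilities *)

Section power_integral.
Local Open Scope classical_set_scope.
Context {d : measure_display} {T : measurableType d} {R : realType}.
Variable P : probability T R.
Local Open Scope ereal_scope.

Lemma integral_probability_cst d' (X : measurableType d') (Q : probability X R)
  (c : \bar R) : \int[Q]_x c = c.
Proof.
by rewrite integral_cst// -[RHS]mule1; congr (_ * _); exact: probability_setT.
Qed.

Definition update {n} (i : 'I_n) (v : T) (U : n.-tuple T) : n.-tuple T :=
  [tuple if j == i then v else tnth U j | j < n].

Definition pullback {m n} (f : 'I_m -> 'I_n) (U : n.-tuple T) : m.-tuple T :=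
  [tuple tnth U (f j) | j < m].

Lemma measurable_fun_mktuple d' (X : measurableType d') n (f : 'I_n -> X -> T) :
  (forall i, measurable_fun [set: X] (f i)) ->
  measurable_fun [set: X] (fun x => [tuple f i x | i < n]).
Proof.
move=> mf; apply/measurable_fun_tnthP => i.
rewrite (_ : _ \o _ = f i)//; apply/funext => x /=; exact: tnth_mktuple.
Qed.

Lemma measurable_update n (i : 'I_n) :
  measurable_fun [set: T * n.-tuple T] (fun p => update i p.1 p.2).
Proof.
apply: measurable_fun_mktuple => j; case: eqP => _; first exact: measurable_fst.
by apply: (@measurableT_comp _ _ _ _ _ _ (fun x => tnth x j)) => //=;
  exact: measurable_tnth.
Qed.

Lemma measurable_pullback m n (f : 'I_m -> 'I_n) :
  measurable_fun [set: n.-tuple T] (pullback f).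
Proof. by apply: measurable_fun_mktuple => j; exact: measurable_tnth. Qed.

Lemma measurable_tcons n : measurable_fun [set: T * n.-tuple T] tcons.
Proof. exact: measurable_cons. Qed.

Lemma measurable_tcons1 n (x : T) :
  measurable_fun [set: n.-tuple T] (fun t => tcons (x, t)).
Proof. by apply: measurable_cons => //; exact: measurable_id. Qed.

Lemma ge0_integral_powerS n (F : n.+1.-tuple T -> \bar R) :
  measurable_fun setT F -> (forall U, 0 <= F U) ->
  \int[power_probability P n.+1]_U F U =
  \int[P]_x \int[power_probability P n]_t F (tcons (x, t)).
Proof.
move=> mF F0; rewrite /= ge0_integral_distribution//=.
rewrite fubini_tonelli1//.
exact: (measurableT_comp mF (@measurable_tcons _)).
Qed.

Lemma measurable_integral_update n (i : 'I_n) (F : n.-tuple T -> \bar R) :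
  measurable_fun setT F -> (forall U, 0 <= F U) ->
  measurable_fun setT (fun U => \int[P]_v F (update i v U)).
Proof.
move=> mF F0.
apply: (measurable_fun_fubini_tonelli_G (m1 := P)
  (fun p : T * n.-tuple T => F (update i p.1 p.2))) => //.
exact: (measurableT_comp mF (measurable_update i)).
Qed.

Lemma update_ord0 n (v x : T) (t : n.-tuple T) :
  update ord0 v (tcons (x, t)) = tcons (v, t).
Proof.
apply: eq_from_tnth => j; rewrite tnth_mktuple.
by case: (unliftP ord0 j) => [k|] -> //=; rewrite /tcons /= !tnthS.
Qed.

Lemma update_lift n (i : 'I_n) (v x : T) (t : n.-tuple T) :
  update (lift ord0 i) v (tcons (x, t)) = tcons (x, update i v t).
Proof.
apply: eq_from_tnth => j; rewrite tnth_mktuple.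
case: (unliftP ord0 j) => [k|] -> //=.
by rewrite (inj_eq lift_inj) /tcons /= !tnthS tnth_mktuple.
Qed.

(** Coordinates are independent with law [P], so one of them may be resampled. In the induction, a
    tail coordinate is treated at fixed head; for the head, the resampled function no longer sees
    the old value, and Tonelli exchanges the two remaining integrals. *)
Lemma ge0_integral_update n (i : 'I_n) (F : n.-tuple T -> \bar R) :
  measurable_fun setT F -> (forall U, 0 <= F U) ->
  \int[power_probability P n]_U F U =
  \int[power_probability P n]_U \int[P]_v F (update i v U).
Proof.
elim: n => [|n IH] in i F *; first by case: i.
move=> mF F0.
have mFc x : measurable_fun setT (fun t : n.-tuple T => F (tcons (x, t))).
  exact: (measurableT_comp mF (measurable_tcons1 x)).
have mFp : measurable_fun setT (fun p : T * n.-tuple T => F (tcons p)).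
  exact: (measurableT_comp mF (@measurable_tcons _)).
rewrite (ge0_integral_powerS mF F0) ge0_integral_powerS; last 2 first.
- exact: measurable_integral_update.
- by move=> U; exact: integral_ge0.
case: (unliftP ord0 i) => [j|] ->.
- apply: eq_integral => x _; rewrite (IH j _ (mFc x) (fun t => F0 _)).
  apply: eq_integral => t _; apply: eq_integral => v _.
  by rewrite update_lift.
- under [RHS]eq_integral => x _ do under eq_integral => t _ do
    under eq_integral => v _ do rewrite update_ord0.
  rewrite integral_probability_cst.
  exact: (fubini_tonelli (fun p : T * n.-tuple T => F (tcons p))).
Qed.

(** Marginals of a product measure: by injectivity, resampling coordinate [f ord0] leaves the other
    selected coordinates untouched. This is used to restrict periodic configurations to the free
    bonds. *)
Lemma ge0_integral_pullback m n (f : 'I_m -> 'I_n) (F : m.-tuple T -> \bar R) :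
  injective f -> measurable_fun setT F -> (forall U, 0 <= F U) ->
  \int[power_probability P n]_U F (pullback f U) =
  \int[power_probability P m]_U F U.
Proof.
elim: m => [|m IH] in f F * => fI mF F0.
  rewrite /= integral_dirac// diracT mul1e.
  under eq_integral => U _ do rewrite (tuple0 (pullback f U)).
  exact: integral_probability_cst.
have mFc x : measurable_fun setT (fun t : m.-tuple T => F (tcons (x, t))).
  exact: (measurableT_comp mF (measurable_tcons1 x)).
rewrite (ge0_integral_update (f ord0))//; last first.
  exact: (measurableT_comp mF (measurable_pullback f)).
have pullbackE v U : pullback f (update (f ord0) v U) =
    tcons (v, pullback (f \o lift ord0) U).
  apply: eq_from_tnth => j; rewrite !tnth_mktuple (inj_eq fI).
  by case: (unliftP ord0 j) => [k|] -> //=; rewrite /tcons /= tnthS tnth_mktuple.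
under eq_integral => U _ do under eq_integral => v _ do rewrite pullbackE.
rewrite -(fubini_tonelli (fun p : T * n.-tuple T =>
    F (tcons (p.1, pullback (f \o lift ord0) p.2))))//; last first.
  apply: (measurableT_comp mF); apply: measurable_cons => /=.
    exact: measurable_fst.
  apply: (@measurableT_comp _ _ _ _ _ _ (pullback (f \o lift ord0))) => //.
  exact: measurable_pullback.
rewrite ge0_integral_powerS//; apply: eq_integral => x _.
apply: (IH (f \o lift ord0) (fun t => F (tcons (x, t)))) => //.
exact: inj_comp fI lift_inj.
Qed.

(* Tonelli, integrating out the coordinate of largest rank first. *)
Lemma ge0_integral_power_prod n (F : 'I_n -> n.-tuple T -> R) (r : 'I_n -> nat)
    (c : \bar R) (S : {set 'I_n}) :
  (forall i, measurable_fun setT (F i)) -> (forall i U, (0 <= F i U)%R) ->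
  (forall i U, i \in S -> \int[P]_v (F i (update i v U))%:E = c) ->
  (forall i j v U, i \in S -> j \in S -> i != j -> (r i <= r j)%N ->
    F i (update j v U) = F i U) ->
  \int[power_probability P n]_U (\prod_(i in S) F i U)%:E = c ^+ #|S|.
Proof.
move=> mF F0; have [m] := ubnP #|S|; elim: m S => // m IH S; rewrite ltnS => Sm.
move=> intF indF; have [->|/set0Pn[i0 i0S]] := eqVneq S finset.set0.
  under eq_integral => U _ do rewrite big_set0.
  by rewrite cards0 integral_probability_cst.
pose j := [arg max_(i > i0 in S) r i].
have [jS jmax] : j \in S /\ (forall i, i \in S -> r i <= r j)%N.
  by rewrite /j; case: arg_maxnP.
have mprod (A : {set 'I_n}) : measurable_fun setT (fun U => (\prod_(i in A) F i U)%:E).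
  apply/measurable_EFinP.
  by under eq_fun => U do rewrite -big_enum; exact: measurable_prod.
have prod0 (A : {set 'I_n}) U : 0 <= (\prod_(i in A) F i U)%:E.
  by rewrite lee_fin prodr_ge0.
rewrite (ge0_integral_update j)//.
(* As [j] has maximal rank, the other factors do not depend on coordinate [j]; the inner integral
   acts on [F j] alone and yields [c]. *)
have -> : (fun U => \int[P]_v (\prod_(i in S) F i (update j v U))%:E) =
    (fun U => c * (\prod_(i in S :\ j) F i U)%:E).
  apply/funext => U; rewrite -(intF _ U jS) muleC -ge0_integralZl//; last 2 first.
  - apply/measurable_EFinP; apply: measurableT_comp => //.
    exact: (measurableT_comp (measurable_update j) (measurable_pair2 U)).
  - by move=> v _; rewrite lee_fin.
  apply: eq_integral => v _; rewrite (big_setD1 j)//= EFinM muleC.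
  congr (_%:E * _); apply: eq_bigr => i; rewrite !inE => /andP[ij iS].
  by rewrite indF// jmax.
have c0 : 0 <= c.
  rewrite -(intF j (nseq_tuple n point) jS).
  by apply: integral_ge0 => v _; rewrite lee_fin.
rewrite ge0_integralZl// IH.
- by rewrite (cardsD1 j S) jS add1n expeS.
- by move: Sm; rewrite (cardsD1 j S) jS.
- by move=> i U /setD1P[_]; exact: intF.
- by move=> i k v U /setD1P[_ iS] /setD1P[_ kS]; exact: indF.
Qed.

End power_integral.

(** * Unitary matrices *)

Section matrix_topology.
Local Open Scope classical_set_scope.
Context {R : realType}.
Local Notation C := R[i].

Lemma cvg_mx_coord (T : topologicalType) m n (X : Type) (F : set_system X)
    (f : X -> 'M[T]_(m, n)) (M : 'M[T]_(m, n)) : Filter F ->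
  (forall i j, f x i j @[x --> F] --> M i j) -> f x @[x --> F] --> M.
Proof.
move=> FF fM A [P MP PA]; apply: (@filterS _ F _ [set x | forall i j, P i j (f x i j)]).
  by move=> x; exact: PA.
apply: (@filter_forall _ _ (fun i => [set x | forall j, P i j (f x i j)])) => i.
by apply: (@filter_forall _ _ (fun j => [set x | P i j (f x i j)])) => j; exact/fM/MP.
Qed.

(** Two outer factors, so as to cover both left translations ([B] the identity) and conjugated
    partial sums of the exponential. *)
Lemma cvg_mulmx m n p q (X : Type) (F : set_system X) (A : 'M[C]_(m, n))
    (B : 'M[C]_(p, q)) (f : X -> 'M[C]_(n, p)) (M : 'M[C]_(n, p)) : Filter F ->
  (forall i j, f x i j @[x --> F] --> M i j) ->
  A *m f x *m B @[x --> F] --> A *m M *m B.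
Proof.
move=> FF fM; apply: cvg_mx_coord => i j.
under eq_cvg => x do rewrite mxE.
rewrite mxE; apply: cvg_big => [|k _]; first exact: add_continuous.
under eq_cvg => x do rewrite mxE.
rewrite mxE; apply: cvgMl; apply: cvg_big => [|l _]; first exact: add_continuous.
by apply: cvgMr; exact: fM.
Qed.

Lemma normc_le_Re_Im (z : C) : `|z| <= (`|complex.Re z| + `|complex.Im z|)%:C%C.
Proof.
rewrite normc_def lecR -[leRHS]ger0_norm ?addr_ge0// -sqrtr_sqr ler_sqrt ?sqr_ge0//.
by rewrite sqrrD !real_normK ?num_real// addrAC lerDl mulrn_wge0// mulr_ge0.
Qed.

Lemma Re_le_normc (z : C) : `|complex.Re z|%:C%C <= `|z|.
Proof.
by rewrite normc_def lecR -sqrtr_sqr ler_sqrt ?addr_ge0 ?sqr_ge0// lerDl sqr_ge0.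
Qed.

Lemma Im_le_normc (z : C) : `|complex.Im z|%:C%C <= `|z|.
Proof.
by rewrite normc_def lecR -sqrtr_sqr ler_sqrt ?addr_ge0 ?sqr_ge0// lerDr sqr_ge0.
Qed.

Lemma cvg_complex (X : Type) (F : set_system X) (f : X -> C) (z : C) : Filter F ->
  complex.Re (f x) @[x --> F] --> complex.Re z ->
  complex.Im (f x) @[x --> F] --> complex.Im z -> f x @[x --> F] --> z.
Proof.
move=> FF fRe fIm; apply/cvgrPdist_lt => e.
(* Positivity in [R[i]] makes [e] real; half of it is allotted to each component. *)
rewrite ltcE /= => /andP[/eqP Ime e0].
have e2 : 0 < complex.Re e / 2 by rewrite divr_gt0.
move/cvgrPdist_lt : fRe => /(_ _ e2); move/cvgrPdist_lt : fIm => /(_ _ e2).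
apply: filterS2 => x Imx Rex; apply: le_lt_trans (normc_le_Re_Im _) _.
rewrite ltcE /= Ime eqxx /= [ltRHS]splitr ltrD//.
- by move: Rex; case: (z) (f x) => [a b] [a' b'].
- by move: Imx; case: (z) (f x) => [a b] [a' b'].
Qed.

Lemma continuous_Re : continuous (@complex.Re R : C -> R).
Proof.
move=> z; have FF : Filter (nbhs z) by exact: nbhs_filter.
apply/(@cvgrPdist_lt _ _ _ _ FF) => e e0.
have : \forall t \near z, `|z - t| < e%:C%C.
  by apply: (@nbhsx_ballx _ C z (e%:C)%C); rewrite ltcR.
apply: filterS => t zt; rewrite -ltcR; apply: le_lt_trans zt.
apply: le_trans (Re_le_normc _); rewrite lecR.
by case: (z) (t) => [a b] [a' b'].
Qed.

Lemma continuous_Im : continuous (@complex.Im R : C -> R).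
Proof.
move=> z; have FF : Filter (nbhs z) by exact: nbhs_filter.
apply/(@cvgrPdist_lt _ _ _ _ FF) => e e0.
have : \forall t \near z, `|z - t| < e%:C%C.
  by apply: (@nbhsx_ballx _ C z (e%:C)%C); rewrite ltcR.
apply: filterS => t zt; rewrite -ltcR; apply: le_lt_trans zt.
apply: le_trans (Im_le_normc _); rewrite lecR.
by case: (z) (t) => [a b] [a' b'].
Qed.

End matrix_topology.

(** * The Hilbert-Schmidt norm and the plaquette estimate *)

Section hilbert_schmidt.
Local Open Scope classical_set_scope.
Context {R : realType}.
Local Notation C := R[i].

Lemma ReD (z w : C) : complex.Re (z + w) = complex.Re z + complex.Re w.
Proof. by case: z w => [a b] [c d]. Qed.

(** The squared Hilbert-Schmidt norm; at U_p - 1 it is the plaquette action. *)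
Definition hs2 {n} (M : 'M[C]_n) : R := complex.Re (\tr (M^t* *m M)).

Lemma hs2E n (M : 'M[C]_n) :
  hs2 M = \sum_i \sum_j (complex.Re (M j i) ^+ 2 + complex.Im (M j i) ^+ 2).
Proof.
rewrite /hs2 /mxtrace raddf_sum; apply: eq_bigr => i _.
rewrite mxE raddf_sum; apply: eq_bigr => j _; rewrite !mxE.
by case: (M j i) => a b /=; rewrite mulNr opprK !expr2.
Qed.

Lemma hs2_ge0 n (M : 'M[C]_n) : 0 <= hs2 M.
Proof.
by rewrite hs2E; do 2 apply: sumr_ge0 => ? _; rewrite addr_ge0 ?sqr_ge0.
Qed.

Lemma hs2D n (A B : 'M[C]_n) : hs2 (A + B) <= 2 * (hs2 A + hs2 B).
Proof.
rewrite !hs2E -big_split mulr_sumr; apply: ler_sum => i _.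
rewrite -big_split mulr_sumr; apply: ler_sum => j _; rewrite mxE.
case: (A j i) (B j i) => [a b] [c d] /=.
have := sqr_ge0 (a - c); have := sqr_ge0 (b - d); nra.
Qed.

Lemma hs2_mulmx_unitary n (A V : 'M[C]_n) : V \is unitarymx -> hs2 (A *m V) = hs2 A.
Proof.
move=> uV; rewrite /hs2 trmx_mul map_mxM mxtrace_mulC -!mulmxA.
by rewrite (mulmxA V) (unitarymxP uV) mul1mx mxtrace_mulC.
Qed.

Lemma Re_trace_adjmx n (A : 'M[C]_n) : complex.Re (\tr (A^t*)) = complex.Re (\tr A).
Proof.
by rewrite trace_map_mx mxtrace_tr; case: (\tr A).
Qed.

Lemma adj_unitarymx n (V : 'M[C]_n) : V \is unitarymx -> V^t* \is unitarymx.
Proof. by rewrite trmxC_unitary. Qed.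

Lemma unitarymxKl n (V : 'M[C]_n) : V \is unitarymx -> V^t* *m V = 1%:M.
Proof. by move=> uV; apply/mulmx1C/unitarymxP. Qed.

(** With W = 1 - V, unitarity reduces the product under the trace to W plus its adjoint, and these
    have the same real trace. *)
Lemma hs2_unitary_sub1 n (V : 'M[C]_n) : V \is unitarymx ->
  hs2 (V - 1%:M) = 2 * complex.Re (\tr (1%:M - V)).
Proof.
move=> uV; have trB : (V - 1%:M)^T = V^T - 1%:M by rewrite linearB /= trmx1.
rewrite /hs2 trB map_mxB map_mx1 mulmxBl mulmxBr mul1mx mulmx1.
rewrite unitarymxKl// -[V - _]opprB opprK.
have -> : 1%:M - V^t* = (1%:M - V)^t* by rewrite linearB /= trmx1 map_mxB map_mx1.
move: (1%:M - V) => W; rewrite mxtraceD ReD Re_trace_adjmx.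
by rewrite -[2]/(1 + 1) mulrDl mul1r.
Qed.

Lemma hs2_adjmx_sub1 n (V : 'M[C]_n) : V \is unitarymx ->
  hs2 (V^t* - 1%:M) = hs2 (V - 1%:M).
Proof.
move=> uV; rewrite !hs2_unitary_sub1 ?trmxC_unitary//.
have -> : 1%:M - V^t* = (1%:M - V)^t* by rewrite linearB /= trmx1 map_mxB map_mx1.
by rewrite Re_trace_adjmx.
Qed.

(* Telescoping: ABC*D* - 1 is a sum of four terms (V - 1) W with W unitary. *)
Lemma hs2_plaquette n (A B C D : 'M[C]_n) :
  A \is unitarymx -> B \is unitarymx -> C \is unitarymx -> D \is unitarymx ->
  hs2 (A *m B *m C^t* *m D^t* - 1%:M) <=
  4 * (hs2 (A - 1%:M) + hs2 (B - 1%:M) + hs2 (C - 1%:M) + hs2 (D - 1%:M)).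
Proof.
move=> uA uB uC uD.
have uC' := adj_unitarymx uC; have uD' := adj_unitarymx uD.
have -> : A *m B *m C^t* *m D^t* - 1%:M =
    ((A - 1%:M) *m (B *m C^t* *m D^t* ) + (B - 1%:M) *m (C^t* *m D^t* )) +
    ((C^t* - 1%:M) *m D^t* + (D^t* - 1%:M)).
  by rewrite !mulmxBl !mul1mx !mulmxA !addrA !subrK.
have uCD := mul_unitarymx uC' uD'.
have uBCD : B *m C^t* *m D^t* \is unitarymx.
  by rewrite -mulmxA; exact: (mul_unitarymx uB uCD).
(* Two nested uses of [hs2D], each costing a factor 2, produce the constant 4. *)
set X := (A - _) *m _ + _; set Y := _ *m D^t* + _.
have hX : hs2 X <= 2 * (hs2 (A - 1%:M) + hs2 (B - 1%:M)).
  rewrite -(hs2_mulmx_unitary (A - 1%:M) uBCD) -(hs2_mulmx_unitary (B - 1%:M) uCD).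
  exact: hs2D.
have hY : hs2 Y <= 2 * (hs2 (C - 1%:M) + hs2 (D - 1%:M)).
  rewrite -(hs2_adjmx_sub1 uC) -(hs2_adjmx_sub1 uD).
  rewrite -(hs2_mulmx_unitary (C^t* - 1%:M) uD').
  exact: hs2D.
apply: le_trans (_ : 2 * (hs2 X + hs2 Y) <= _); first exact: hs2D.
move: (hs2 X) (hs2 Y) hX hY => x y.
move: (hs2 (A - _)) (hs2 (B - _)) (hs2 (C - _)) (hs2 (D - _)) => a b c e.
lra.
Qed.

End hilbert_schmidt.

(** * Haar measure *)

Section mx_measurable.
Local Open Scope classical_set_scope.
Context {d} {X : measurableType d} {R : realType}.
Local Notation C := R[i].

Definition mx_measurable {m n} (f : X -> 'M[C]_(m, n)) :=
  forall i j, measurable_fun setT (fun x => complex.Re (f x i j)) /\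
              measurable_fun setT (fun x => complex.Im (f x i j)).

Lemma mx_measurable_cst m n (M : 'M[C]_(m, n)) : mx_measurable (fun=> M).
Proof. by move=> i j; split; exact: measurable_cst. Qed.

Lemma mx_measurable_adj m n (f : X -> 'M[C]_(m, n)) :
  mx_measurable f -> mx_measurable (fun x => (f x)^t*).
Proof.
move=> mf i j; have [mRe mIm] := mf j i; split.
  by apply: eq_measurable_fun mRe => x _; rewrite !mxE; case: (f x j i).
apply: (@eq_measurable_fun _ _ _ _ _ (fun x => - complex.Im (f x j i))).
  by move=> x _; rewrite !mxE; case: (f x j i).
by apply: measurableT_comp => //; exact: oppr_measurable.
Qed.

Lemma mx_measurable_mul m n p (f : X -> 'M[C]_(m, n)) (g : X -> 'M[C]_(n, p)) :
  mx_measurable f -> mx_measurable g -> mx_measurable (fun x => f x *m g x).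
Proof.
move=> mf mg i j.
pose rr k x := complex.Re (f x i k) * complex.Re (g x k j).
pose ii k x := complex.Im (f x i k) * complex.Im (g x k j).
pose ri k x := complex.Re (f x i k) * complex.Im (g x k j).
pose ir k x := complex.Im (f x i k) * complex.Re (g x k j).
split.
- apply: (@eq_measurable_fun _ _ _ _ _ (fun x => \sum_k (rr k x - ii k x))).
    move=> x _; rewrite mxE raddf_sum; apply: eq_bigr => k _.
    by rewrite /rr /ii; case: (f x i k) (g x k j) => [a b] [c e].
  apply: measurable_sum => k; have [? ?] := mf i k; have [? ?] := mg k j.
  by apply: measurable_funB; exact: measurable_funM.
- apply: (@eq_measurable_fun _ _ _ _ _ (fun x => \sum_k (ri k x + ir k x))).
    move=> x _; rewrite mxE raddf_sum; apply: eq_bigr => k _.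
    by rewrite /ri /ir; case: (f x i k) (g x k j) => [a b] [c e].
  apply: measurable_sum => k; have [? ?] := mf i k; have [? ?] := mg k j.
  by apply: measurable_funD; exact: measurable_funM.
Qed.

(** With k twice the coupling, this is the weight of one plaquette; see [expR_action]. *)
Definition boltzmann (k : R) {n} (M : 'M[C]_n) : R :=
  expR (- (k * complex.Re (\tr (1%:M - M)))).

Lemma boltzmann_ge0 k n (M : 'M[C]_n) : 0 <= boltzmann k M.
Proof. exact: expR_ge0. Qed.

Lemma measurable_boltzmann k n (f : X -> 'M[C]_n) :
  mx_measurable f -> measurable_fun setT (fun x => boltzmann k (f x)).
Proof.
move=> mf; apply: (@eq_measurable_fun _ _ _ _ _
    (fun x => expR (- (k * (\sum_i (1 - complex.Re (f x i i))))))).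
  move=> x _; congr (expR (- (k * _))); rewrite /mxtrace raddf_sum.
  by apply: eq_bigr => i _; rewrite !mxE eqxx; case: (f x i i).
apply: measurableT_comp; first exact: measurable_expR.
apply: measurableT_comp; first exact: oppr_measurable.
apply: measurable_funM; first exact: measurable_cst.
apply: measurable_sum => i; apply: measurable_funB; first exact: measurable_cst.
by have [] := mf i i.
Qed.

End mx_measurable.

(** * Invariance of Haar integrals *)

Section haar.
Local Open Scope classical_set_scope.
Context {R : realType} {N : nat}.
Local Notation C := R[i].

Lemma continuous_coord_unitary i j : continuous (fun U : unitary R N => \val U i j).
Proof.
move=> U; apply: (@continuous_comp _ _ _ (fun U : unitary R N => \val U)
  (fun M : 'M[C]_N => M i j)); first exact: initial_continuous.
exact: coord_continuous.
Qed.

Lemma continuous_measurable_borelU (f : unitary R N -> R) :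
  continuous f -> measurable_fun [set: borelU R N] (f : borelU R N -> R).
Proof.
move=> /continuousP cf; apply: (measurability _ (RGenOpens.measurableE R)).
move=> _ [_ [a [b ->] <-]]; rewrite setTI; apply: sub_sigma_algebra.
exact/cf/interval_open.
Qed.

Lemma mx_measurable_val :
  mx_measurable (fun U : borelU R N => \val (U : unitary R N) : 'M[C]_N).
Proof.
move=> i j; split; apply: continuous_measurable_borelU => U.
- apply: (@continuous_comp _ _ _ (fun U : unitary R N => \val U i j) (@complex.Re R)).
    exact: continuous_coord_unitary.
  exact: continuous_Re.
- apply: (@continuous_comp _ _ _ (fun U : unitary R N => \val U i j) (@complex.Im R)).
    exact: continuous_coord_unitary.
  exact: continuous_Im.
Qed.

Lemma unitary_is_unitarymx (U : unitary R N) : \val U \is unitarymx.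
Proof. exact: set_mem (valP U). Qed.

Lemma continuous_unitaryM (V : unitary R N) : continuous (unitaryM V).
Proof.
apply: continuous_comp_initial => U.
have := @cvg_mulmx R _ _ _ _ _ (nbhs U) (\val V) 1%:M
  (fun U : unitary R N => \val U) (\val U).
rewrite mulmx1 => /(_ (nbhs_filter U) (fun i j => @continuous_coord_unitary i j U)).
by under eq_cvg do rewrite mulmx1; exact.
Qed.

Lemma measurable_unitaryM (V : unitary R N) :
  measurable_fun [set: borelU R N] (unitaryM V : borelU R N -> borelU R N).
Proof.
apply: (@measurability _ _ (borelU R N) (borelU R N) setT (unitaryM V)
  (@open (unitary R N))) => // _ [A oA <-].
rewrite setTI; apply: sub_sigma_algebra.
by move/continuousP : (@continuous_unitaryM V); exact.
Qed.

Lemma unitary_adj_proof (V : unitary R N) : (\val V)^t* \is unitarymx.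
Proof. by rewrite trmxC_unitary unitary_is_unitarymx. Qed.

Definition mk_unitary (M : 'M[C]_N) (uM : M \is unitarymx) : unitary R N :=
  exist _ M (mem_set (uM : [set U | U \is unitarymx] M)).

(** The change of variables involves preimages, whereas [is_haar] speaks of translated sets. They
    match because the translate by [V] of the preimage of [A] is [A] itself, [V] being invertible
    with inverse its adjoint. *)
Lemma ge0_integral_haar (sigma : probability (borelU R N) R) (V : unitary R N)
    (f : borelU R N -> \bar R) : is_haar sigma ->
  measurable_fun setT f -> (forall U, (0 <= f U)%E) ->
  (\int[sigma]_U f (unitaryM V U) = \int[sigma]_U f U)%E.
Proof.
move=> haar mf f0.
have := ge0_integral_pushforward (measurable_unitaryM V) sigma measurableT mf
  (fun y _ => f0 y).
rewrite preimage_setT /= => <-; apply: (eq_measure_integral sigma) => [|mV A mA _].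
  exact: measurable_unitaryM.
transitivity (sigma (unitaryM V @^-1` A)); first by [].
rewrite -(haar V); last first.
  by rewrite -[X in measurable X]setTI; exact: measurable_unitaryM.
congr (sigma _); apply/seteqP; split => [_ [U ? <-]//|U AU].
exists (unitaryM (mk_unitary (unitary_adj_proof V)) U).
  rewrite /= (_ : unitaryM V _ = U)//; apply: val_inj => /=.
  by rewrite mulmxA (unitarymxP (unitary_is_unitarymx V)) mul1mx.
apply: val_inj => /=.
by rewrite mulmxA (unitarymxP (unitary_is_unitarymx V)) mul1mx.
Qed.

(* The Boltzmann weight is a class function, so left invariance suffices. *)
Lemma ge0_integral_haar_boltzmann (sigma : probability (borelU R N) R) (k : R)
    (A B : 'M[C]_N) : is_haar sigma -> A \is unitarymx -> B \is unitarymx ->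
  (\int[sigma]_U (boltzmann k (A *m \val (U : unitary R N) *m B))%:E =
   \int[sigma]_U (boltzmann k (\val (U : unitary R N)))%:E)%E.
Proof.
move=> haar uA uB.
(* By cyclicity tr (A U B) = tr (B A U), so the two-sided product becomes a left translation by
   BA. *)
pose V := mk_unitary (mul_unitarymx uB uA).
pose f (U : borelU R N) : \bar R := (boltzmann k (\val (U : unitary R N)))%:E.
have mf : measurable_fun setT f.
  by apply/measurable_EFinP; apply: measurable_boltzmann; exact: mx_measurable_val.
rewrite -[RHS]/(\int[sigma]_U f U)%E -(ge0_integral_haar V haar mf); last first.
  by move=> U; rewrite lee_fin boltzmann_ge0.
apply: eq_integral => U _; rewrite /f /boltzmann /=.
rewrite (_ : \tr (1%:M - A *m \val U *m B) = \tr (1%:M - B *m A *m \val U))//.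
by rewrite !raddfB /= mxtrace_mulC !mulmxA.
Qed.

End haar.

(** * Logarithm of a unitary matrix *)

Section exponential.
Local Open Scope classical_set_scope.
Context {R : realType}.
Local Notation C := R[i].

Definition expi (t : R) : C := (cos t +i* sin t)%C.

(** The parity indicators and halved exponents are those of [cos_coeff] and [sin_coeff]. *)
Lemma exp_imaginary (n : nat) : ('i : C) ^+ n =
  (((~~ odd n)%:R * (-1) ^+ n./2) +i* ((odd n)%:R * (-1) ^+ n.-1./2))%C.
Proof.
have i2 m : ('i : C) ^+ m.*2 = (((-1) ^+ m : R)%:C)%C.
  by rewrite -muln2 mulnC exprM sqrCi rmorphXn rmorphN1.
rewrite -[in LHS](odd_double_half n) exprD i2.
have [on|en] := boolP (odd n).
- have -> : n.-1./2 = n./2.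
    by rewrite -{1}(odd_double_half n) on add1n /= doubleK.
  rewrite expr1 mul0r mul1r; apply/eqP; rewrite eq_complex /=.
  by apply/andP; split; apply/eqP; ring.
- by rewrite expr0 !mul1r mul0r.
Qed.

Lemma expi_coeff (t : R) (n : nat) :
  n`!%:R^-1 * ('i * (t%:C)%C) ^+ n = (cos_coeff t n +i* sin_coeff t n)%C :> C.
Proof.
have fE : (n`!%:R^-1 : C) = ((n`!%:R^-1 : R)%:C)%C.
  by rewrite fmorphV rmorph_nat.
rewrite exprMn -(rmorphXn (real_complex R)) /= fE exp_imaginary.
rewrite /cos_coeff /sin_coeff /= -exprnP.
by apply/eqP; rewrite eq_complex /=; apply/andP; split; apply/eqP; ring.
Qed.

Lemma cvg_expi (t : R) :
  series (fun n => n`!%:R^-1 * ('i * (t%:C)%C) ^+ n : C) n @[n --> \oo] --> expi t.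
Proof.
apply: cvg_complex.
- under eq_cvg => n.
    rewrite seriesEnat /= raddf_sum /=.
    under eq_bigr => k _ do rewrite expi_coeff /=.
    over.
  rewrite /= cos.unlock; exact: is_cvg_series_cos_coeff.
- under eq_cvg => n.
    rewrite seriesEnat /= raddf_sum /=.
    under eq_bigr => k _ do rewrite expi_coeff /=.
    over.
  rewrite /= sin.unlock; exact: is_cvg_series_sin_coeff.
Qed.

Lemma conj_diag_mxX n (P : 'M[C]_n) (d : 'rV[C]_n) k : P \is unitarymx ->
  (P^t* *m diag_mx d *m P) ^+ k = P^t* *m diag_mx (map_mx (fun z => z ^+ k) d) *m P.
Proof.
move=> uP; elim: k => [|k IH].
  rewrite expr0 (_ : map_mx _ d = const_mx 1); last first.
    by apply/matrixP => i j; rewrite !mxE.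
  by rewrite diag_const_mx mulmx1 unitarymxKl.
rewrite exprS IH -[_ * _]/(_ *m _) !mulmxA -(mulmxA _ P) (unitarymxP uP) mulmx1.
congr (_ *m _); rewrite -!mulmxA; congr (_ *m _); rewrite mulmx_diag.
by congr diag_mx; apply/matrixP => i j; rewrite !mxE exprS ord1.
Qed.

(** Conjugation by [P] passes through each partial sum, which is thus a conjugated diagonal matrix;
    the limit is then scalar, entry by entry. *)
Lemma expmx_conj_diag n (P : 'M[C]_n) (d : 'rV[C]_n) (t : 'rV[R]_n) :
  P \is unitarymx -> (forall j, d 0 j = 'i * ((t 0 j)%:C)%C) ->
  expmx (P^t* *m diag_mx d *m P) = P^t* *m diag_mx (map_mx expi t) *m P.
Proof.
move=> uP dE; apply/cvg_lim; first exact: (@norm_hausdorff C 'M[C]_n).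
have seriesE k : series (fun k : nat => k`!%:R^-1 *: (P^t* *m diag_mx d *m P) ^+ k) k =
    P^t* *m diag_mx (\row_j series (fun k => k`!%:R^-1 * (d 0 j) ^+ k) k) *m P.
  rewrite seriesEnat /=.
  under eq_bigr => l _ do rewrite conj_diag_mxX// scalemxAl scalemxAr.
  rewrite -mulmx_suml -mulmx_sumr; congr (_ *m _ *m _).
  apply/matrixP => i j; rewrite summxE !mxE.
  under eq_bigr => l _ do rewrite !mxE mulrnAr.
  by rewrite sumrMnl seriesEnat.
under eq_cvg => k do rewrite seriesE.
apply: cvg_mulmx => i j; rewrite !mxE.
under eq_cvg => k do rewrite !mxE.
have [->|ij] := eqVneq i j; last by rewrite mulr0n; exact: cvg_cst.
rewrite !mulr1n dE; exact: cvg_expi.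
Qed.

End exponential.

(** * Existence of logarithms and comparison of chord with arc *)

Section logarithm.
Local Open Scope classical_set_scope.
Context {R : realType}.
Local Notation C := R[i].

Lemma sin_le_id (x : R) : 0 <= x -> sin x <= x.
Proof.
rewrite le_eqVlt => /predU1P[<-|x0]; first by rewrite sin0.
have [c _] := @MVT_segment R sin cos 0 x (ltW x0) (fun y _ => is_derive_sin y)
  (continuous_subspaceT (@continuous_sin R)).
by rewrite sin0 !subr0 => ->; rewrite -[leRHS]mul1r (ler_wpM2r (ltW x0))// cos_le1.
Qed.

Lemma sqr_sin_le (x : R) : sin x ^+ 2 <= x ^+ 2.
Proof.
rewrite -[x ^+ 2]real_normK ?num_real// -[sin x ^+ 2]real_normK ?num_real//.
rewrite lerXn2r ?nnegrE//.
wlog x0 : x / 0 <= x => [H|].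
  have [x0|x0] := leP 0 x; first exact: H.
  by rewrite -[leLHS]normrN -sinN -[leRHS]normrN; apply: H; rewrite oppr_ge0 ltW.
rewrite (ger0_norm x0) ler_norml sin_le_id// andbT.
(* For -x <= sin x: the sine is nonnegative on [0, pi], and beyond pi one has x > 1 while sin x >=
   -1. *)
have := @sin_le_id x x0; have [x1|x1] := leP x pi.
  move=> _; apply: le_trans (_ : 0 <= _); first by rewrite oppr_le0.
  by apply: sin_ge0_pi; rewrite x0.
move=> _; apply: le_trans (sin_geN1 x); rewrite lerN2.
by apply: ltW; apply: le_lt_trans x1; have := pi_ge2 R; lra.
Qed.

(** The squared chord of the unit circle is at most the squared arc: by the half-angle formula the
    left side is 4 sin^2 (x/2). *)
Lemma one_sub_cos_le (x : R) : 2 * (1 - cos x) <= x ^+ 2.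
Proof.
have -> : x = (x / 2) *+ 2 by rewrite -mulr_natr divfK.
rewrite cos_mulr2n; have := sqr_sin_le (x / 2); have := cos2Dsin2 (x / 2).
move: (sin _ ^+ 2) (cos _ ^+ 2) => s c; rewrite -mulr_natr exprMn; lra.
Qed.

Lemma expi_surj (z : C) : complex.Re z ^+ 2 + complex.Im z ^+ 2 = 1 ->
  exists t : R, - pi < t <= pi /\ expi t = z.
Proof.
case: z => a b /= ab.
have a1 : -1 <= a <= 1.
  have : a ^+ 2 <= 1 by rewrite -ab lerDl sqr_ge0.
  rewrite -ler_norml -[in X in _ -> X](@ler_pXn2r _ 2)// ?nnegrE// expr1n.
  by rewrite real_normK ?num_real.
have [ac0 acpi] : 0 <= acos a /\ acos a <= pi.
  by have /andP[] := (acos_def a1).1.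
have sb : sin (acos a) = `|b|.
  by rewrite sin_acos// -ab addrAC subrr add0r sqrtr_sqr.
have [b0|b0] := leP 0 b.
- exists (acos a); split; last by rewrite /expi acosK// sb ger0_norm.
  by rewrite acpi andbT; apply: lt_le_trans ac0; rewrite oppr_lt0 pi_gt0.
- exists (- acos a); split; last first.
    by rewrite /expi cosN sinN acosK// sb ltr0_norm ?opprK.
  apply/andP; split; last by apply: le_trans (pi_ge0 R); rewrite oppr_le0.
  (* The endpoint -pi does not occur: [acos a = pi] would give b = 0, against b < 0. *)
  rewrite ltrN2 lt_neqAle acpi andbT; apply/eqP => acpi'.
  by move: sb; rewrite acpi' sinpi => /esym/eqP; rewrite normr_eq0 lt_eqF.
Qed.

Lemma mxtrace_conj_diag n (P : 'M[C]_n) (d : 'rV[C]_n) : P \is unitarymx ->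
  \tr (P^t* *m diag_mx d *m P) = \sum_j d 0 j.
Proof.
by move=> uP; rewrite mxtrace_mulC mulmxA (unitarymxP uP) mul1mx mxtrace_diag.
Qed.

Lemma conj_diag_adj n (P : 'M[C]_n) (d : 'rV[C]_n) :
  (P^t* *m diag_mx d *m P)^t* = P^t* *m diag_mx (map_mx Num.conj d) *m P.
Proof.
by rewrite !trmx_mul !map_mxM mulmxA trmxCK tr_diag_mx map_diag_mx.
Qed.

(** In an orthonormal eigenbasis of [X] with real eigenvalues t_j, the two sides are the sums of 2
    (1 - cos t_j) and of t_j^2. *)
Lemma is_log_bound n (U X : 'M[C]_n) : is_log U X ->
  2 * complex.Re (\tr (1%:M - U)) <= complex.Re (\tr (X *m X)).
Proof.
case=> hX _ <-.
pose P := spectralmx X; have uP : P \is unitarymx by exact: spectral_unitarymx.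
have XE : X = P^t* *m diag_mx (spectral_diag X) *m P.
  have /orthomx_spectralP XE := hermitian_normalmx hX.
  by rewrite [LHS]XE (invmx_unitary uP).
pose t := map_mx (@complex.Re R) (spectral_diag X).
have tE : spectral_diag X = map_mx (real_complex R) t.
  apply/matrixP => i j; rewrite !mxE RRe_real//.
  by have /mxOverP := hermitian_spectral_diag_real hX; exact.
have trX : complex.Re (\tr (X *m X)) = \sum_j t 0 j ^+ 2.
  have -> : X *m X = P^t* *m diag_mx (map_mx (fun z => z ^+ 2) (spectral_diag X)) *m P.
    by rewrite -conj_diag_mxX// -XE.
  rewrite mxtrace_conj_diag// tE raddf_sum; apply: eq_bigr => j _.
  by rewrite !mxE /= mulr0 subr0.
have iX : 'i *: X = P^t* *m diag_mx ('i *: spectral_diag X) *m P.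
  by rewrite {1}XE scalemxAl scalemxAr [in RHS]linearZ /=.
rewrite iX (expmx_conj_diag (t := t))//; last by move=> j; rewrite tE !mxE.
rewrite linearB /= mxtrace_conj_diag// mxtrace1 trX.
have -> : n%:R - \sum_j map_mx expi t 0 j = \sum_j (1 - expi (t 0 j)) :> C.
  rewrite sumrB sumr_const card_ord; congr (_ - _).
  by apply: eq_bigr => j _; rewrite mxE.
rewrite raddf_sum mulr_sumr; apply: ler_sum => j _ /=; exact: one_sub_cos_le.
Qed.

(** A unitary matrix is normal, hence unitarily diagonalizable with eigenvalues of modulus 1; [X]
    carries their arguments in the same eigenbasis. *)
Lemma exists_log n (U : 'M[C]_n) : U \is unitarymx -> exists X, is_log U X.
Proof.
move=> uU.
have nU : U \is normalmx by apply/normalmxP; rewrite (unitarymxP uU) unitarymxKl.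
pose P := spectralmx U; have uP : P \is unitarymx by exact: spectral_unitarymx.
pose s := spectral_diag U.
have UE : U = P^t* *m diag_mx s *m P.
  have /orthomx_spectralP UE := nU.
  by rewrite [LHS]UE (invmx_unitary uP).
have s1 j : complex.Re (s 0 j) ^+ 2 + complex.Im (s 0 j) ^+ 2 = 1.
  have sE : diag_mx s = P *m U *m P^t*.
    rewrite [in RHS]UE !mulmxA (unitarymxP uP) mul1mx -mulmxA.
    by rewrite (unitarymxP uP) mulmx1.
  have : diag_mx s \is unitarymx.
    by rewrite sE; exact: mul_unitarymx (mul_unitarymx uP uU) (adj_unitarymx uP).
  move/unitarymxP.
  rewrite tr_diag_mx map_diag_mx mulmx_diag => /matrixP /(_ j j).
  rewrite !mxE eqxx !mulr1n; case: (s 0 j) => a b /= /eqP; rewrite eq_complex /=.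
  by move=> /andP[/eqP <- _]; ring.
have [t tE] : exists t : 'rV[R]_n, forall j, - pi < t 0 j <= pi /\ expi (t 0 j) = s 0 j.
  have /choice[t tE] := fun j => expi_surj (s1 j).
  by exists (\row_j t j) => j; rewrite mxE.
pose d := map_mx (real_complex R) t.
exists (P^t* *m diag_mx d *m P); split.
- apply/is_hermitianmxP; rewrite expr0 scale1r conj_diag_adj.
  rewrite (_ : map_mx _ d = d)//; apply/matrixP => i j; rewrite !mxE.
  by rewrite -[LHS]/(conjc _) conjc_real.
(* Written in the eigenbasis, an eigenvector has some nonzero coordinate j, which forces z = t_j. *)
- move=> z /eigenvalueP[v vX v0].
  have wd : (v *m P^t* ) *m diag_mx d = z *: (v *m P^t* ).
    have := congr1 (fun M : 'rV[C]_n => M *m P^t* ) vX; rewrite /= -scalemxAl => <-.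
    by rewrite -!mulmxA (unitarymxP uP) mulmx1.
  have w0 : v *m P^t* != 0.
    apply: contraNneq v0 => w0; rewrite -[v]mulmx1 -(unitarymxKl uP) mulmxA w0.
    by rewrite mul0mx.
  have [j wj] : exists j, (v *m P^t* ) 0 j != 0.
    apply/existsP; apply: contraNT w0; rewrite negb_exists => /forallP w0.
    apply/eqP/matrixP => i j; rewrite ord1 [RHS]mxE; apply/eqP.
    by rewrite -[_ == _]negbK w0.
  have /matrixP/(_ 0 j) := wd; rewrite mul_mx_diag !mxE mulrC => /(mulIf _) zE.
  have <- : ((t 0 j)%:C)%C = z by apply: zE; move: wj; rewrite mxE.
  have [/andP[t1 t2] _] := tE j.
  by rewrite -(rmorphN (real_complex R)) /= ltcR lecR t1.
- have -> : 'i *: (P^t* *m diag_mx d *m P) = P^t* *m diag_mx ('i *: d) *m P.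
    by rewrite scalemxAl scalemxAr [in RHS]linearZ /=.
  rewrite (expmx_conj_diag (t := t))//; last by move=> j; rewrite !mxE.
  rewrite (_ : map_mx expi t = s); first exact: esym UE.
  by apply/matrixP => i j; rewrite !mxE ord1 (tE j).2.
Qed.

Lemma log_unitary_bound N (U : unitary R N) :
  2 * complex.Re (\tr (1%:M - \val U)) <=
  complex.Re (\tr (log_unitary U *m log_unitary U)).
Proof.
(* [xget] falls back on its default 0 only if no logarithm exists, which [exists_log] excludes. *)
apply: is_log_bound; rewrite /log_unitary; case: xgetP => [X _ //|noX].
by have [X /noX] := exists_log (unitary_is_unitarymx U).
Qed.

End logarithm.

(** * The comb tree *)

Section comb_tree.
Local Open Scope classical_set_scope.
Variables d L : nat.
Implicit Types (x : site d L) (mu nu : 'I_d) (b : site d L * 'I_d).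

(** Also the length of the tree path from the origin to [x]. *)
Definition height x : nat := \sum_k x k.

Definition low_zero x mu : bool :=
  [forall k : 'I_d, (k < mu)%N ==> (x k == 0%N :> nat)].

Lemma low_zeroP x mu :
  reflect (forall k : 'I_d, (k < mu)%N -> x k = 0%N :> nat) (low_zero x mu).
Proof.
rewrite /low_zero; apply: (iffP forallP) => z k; have := z k.
- by move=> /implyP h kmu; exact/eqP/h.
- by move=> h; apply/implyP => /h /eqP.
Qed.

Definition tree_bond b : bool := has_succ b.1 b.2 && low_zero b.1 b.2.

(** The tree consists of free bonds, so for [Periodic] every extra bond is retained. *)
Definition retained (B : boundary) b : bool := is_bond B b && ~~ tree_bond b.

(** The direction of the last bond on the tree path to [x]; [None] exactly at the origin. *)
Definition lead x : option 'I_d :=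
  [pick k : 'I_d | (x k != 0%N :> nat) && low_zero x k].

Definition unshift x mu : site d L := [ffun k => if k == mu then ord_pred (x k) else x k].

Lemma shift_unshift x mu : shift (unshift x mu) mu = x.
Proof. by apply/ffunP => k; rewrite !ffunE; case: eqP => // _; rewrite ord_predK. Qed.

Lemma unshift_shift x mu : unshift (shift x mu) mu = x.
Proof. by apply/ffunP => k; rewrite !ffunE; case: eqP => // _; rewrite ordSK. Qed.

Lemma shiftC x mu nu : shift (shift x mu) nu = shift (shift x nu) mu.
Proof. by apply/ffunP => k; rewrite !ffunE; case: (k == mu); case: (k == nu). Qed.

Lemma shift_bij mu : bijective (fun x => shift x mu).
Proof. by exists (fun x => unshift x mu) => x; rewrite ?shift_unshift ?unshift_shift. Qed.

Lemma shiftE x mu k : has_succ x mu -> shift x mu k = (x k + (k == mu))%N :> nat.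
Proof.
rewrite /has_succ ffunE; have [->|_] := eqVneq k mu; last by rewrite addn0.
by move=> xL; rewrite /= modn_small// addn1.
Qed.

Lemma unshiftE x mu k : (x mu != 0%N :> nat) -> x k = (unshift x mu k + (k == mu))%N :> nat.
Proof.
rewrite ffunE; have [->|_] := eqVneq k mu; last by rewrite addn0.
rewrite -lt0n => x0 /=; have xL := ltn_ord (x mu).
have -> : ((x mu + L).-1 = (x mu).-1 + L)%N by rewrite -!subn1 addnBAC.
rewrite modnDr modn_small; last exact: leq_ltn_trans (leq_pred _) xL.
by rewrite addn1 prednK.
Qed.

Lemma height_shift x mu : has_succ x mu -> height (shift x mu) = (height x).+1.
Proof.
move=> xmu; rewrite /height (eq_bigr _ (fun k _ => shiftE k xmu)) big_split /=.
rewrite -addn1; congr addn; rewrite (bigD1 mu)//= eqxx big1 ?addn0// => k /negPf ->.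
by [].
Qed.

Lemma has_succ_unshift x mu : (x mu != 0%N :> nat) -> has_succ (unshift x mu) mu.
Proof.
move=> x0; have := unshiftE mu x0; rewrite eqxx addn1 /has_succ => <-.
exact: ltn_ord.
Qed.

Lemma height_unshift x mu : (x mu != 0%N :> nat) -> height x = (height (unshift x mu)).+1.
Proof. by move=> x0; rewrite -(height_shift (has_succ_unshift x0)) shift_unshift. Qed.

Lemma height_lt x : (height x < d * L + 1)%N.
Proof.
rewrite addn1 ltnS -[d in (d * _)%N]card_ord -sum_nat_const.
by apply: leq_sum => k _; exact: ltnW.
Qed.

Lemma lead_uniq x mu nu : (x mu != 0%N :> nat) -> low_zero x mu ->
  (x nu != 0%N :> nat) -> low_zero x nu -> mu = nu.
Proof.
move=> xmu /low_zeroP zmu xnu /low_zeroP znu; apply: ord_inj.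
case: (ltngtP mu nu) => // h; first by rewrite znu in xmu.
by rewrite zmu in xnu.
Qed.

Lemma leadP x mu : (lead x == Some mu) = (x mu != 0%N :> nat) && low_zero x mu.
Proof.
rewrite /lead; case: pickP => [k /andP[xk zk]|none].
- apply/eqP/andP => [[<-]//|[xmu zmu]]; congr Some; exact: lead_uniq zk xmu zmu.
- by rewrite none.
Qed.

(** The smallest direction with a nonzero coordinate. For a retained free bond in direction [mu] it
    spans, together with [mu], the attached plaquette. *)
Lemma lead_not_low x mu : ~~ low_zero x mu ->
  exists nu, [/\ lead x = Some nu & (nu < mu)%N].
Proof.
rewrite /low_zero negb_forall => /existsP[k0]; rewrite negb_imply => /andP[k0mu xk0].
case: (@arg_minnP _ k0 (fun k : 'I_d => x k != 0%N :> nat) (@nat_of_ord d) xk0).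
move=> nu xnu numin.
exists nu; split; last exact: leq_ltn_trans (numin _ xk0) k0mu.
apply/eqP; rewrite leadP xnu /=; apply/low_zeroP => k kn; apply/eqP.
by apply: contraLR kn => xk; rewrite -leqNgt numin.
Qed.

(** Together with [lead_tree_bond]: each site other than the origin is the end point of exactly one
    tree bond. *)
Lemma tree_bond_lead x mu : tree_bond (x, mu) -> lead (shift x mu) = Some mu.
Proof.
move=> /andP[/= xs /low_zeroP z]; apply/eqP; rewrite leadP shiftE// eqxx addn1 /=.
by apply/low_zeroP => k km; rewrite shiftE// z// -val_eqE ltn_eqF.
Qed.

Lemma lead_tree_bond x nu : lead x = Some nu -> tree_bond (unshift x nu, nu).
Proof.
move=> /eqP; rewrite leadP => /andP[x0 /low_zeroP z].
rewrite /tree_bond /= has_succ_unshift//=; apply/low_zeroP => k kn.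
by have := z k kn; rewrite (unshiftE k x0) => /eqP; rewrite addn_eq0 => /andP[/eqP].
Qed.

(** Encodes the lexicographic order on (direction, height) in one number: by [height_lt] the base
    [d * L + 1] exceeds every height. *)
Definition bond_rank b : nat := (b.2 * (d * L + 1) + height b.1)%N.

Lemma bond_rank_dir x y mu nu : (nu < mu)%N ->
  (bond_rank (y, nu) < bond_rank (x, mu))%N.
Proof. by rewrite /bond_rank /= => nm; have := height_lt y; nia. Qed.

Lemma bond_rank_unshift x mu nu : (x nu != 0%N :> nat) ->
  (bond_rank (unshift x nu, mu) < bond_rank (x, mu))%N.
Proof. by move=> x0; rewrite /bond_rank /= (height_unshift x0) ltn_add2l. Qed.

(** The value at the origin is a placeholder, and no plaquette since its two directions agree; no
    retained free bond starts there. *)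
Definition lead_plaquette b : site d L * 'I_d * 'I_d :=
  if lead b.1 is Some nu then (unshift b.1 nu, nu, b.2) else (b.1, b.2, b.2).

Lemma lead_plaquetteP b : retained Free b -> is_plaquette Free (lead_plaquette b).
Proof.
case: b => x mu /andP[/= xs]; rewrite /tree_bond /= xs /= => /lead_not_low[nu [xnu nm]].
rewrite /lead_plaquette /= xnu /= nm /=.
move/eqP: xnu; rewrite leadP => /andP[x0 _].
rewrite has_succ_unshift//=; move: xs; rewrite /has_succ (unshiftE mu x0).
by have -> : (mu == nu) = false by [rewrite -val_eqE gtn_eqF]; rewrite addn0.
Qed.

(** The bond is recovered from its plaquette (y, nu, mu) as (y + e^nu, mu). *)
Lemma lead_plaquette_inj : {in [pred b | retained Free b] &, injective lead_plaquette}.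
Proof.
move=> [x mu] [y rho]; rewrite !inE => /andP[/= xs].
rewrite /tree_bond /= xs /= => /lead_not_low[nu [xnu _]] /andP[/= ys].
rewrite /tree_bond /= ys /= => /lead_not_low[nu' [ynu' _]].
rewrite /lead_plaquette /= xnu ynu' => -[xy nn ->].
by rewrite -(shift_unshift x nu) xy nn shift_unshift.
Qed.

End comb_tree.

(** * Counting bonds *)

Section counting.
Local Open Scope classical_set_scope.
Variables d L : nat.

Lemma card_site_dir (Q : pred (site d L * 'I_d)) :
  #|Q| = (\sum_mu #|[pred x | Q (x, mu)]|)%N.
Proof.
rewrite -sum1_card big_mkcond /=.
rewrite (eq_bigr (fun p => if Q (p.1, p.2) then 1 else 0)%N); last by case.
rewrite -(pair_bigA _ (fun x mu => if Q (x, mu) then 1 else 0)%N) /=.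
rewrite exchange_big; apply: eq_bigr => mu _.
by rewrite -sum1_card [RHS]big_mkcond.
Qed.

Lemma card_ord_eq0 (l : nat) : #|[pred i : 'I_l.+1 | i == 0%N :> nat]| = 1%N.
Proof. by rewrite -(card1 (ord0 : 'I_l.+1)); apply: eq_card => i; rewrite !inE. Qed.

Lemma card_ord_succ (l : nat) : #|[pred i : 'I_l.+1 | (i.+1 < l.+1)%N]| = l.
Proof.
transitivity #|predC1 (ord_max : 'I_l.+1)|; last first.
  by have := cardC1 (ord_max : 'I_l.+1); rewrite card_ord.
apply: eq_card => i; rewrite !inE ltnS -val_eqE /= ltn_neqAle.
by rewrite -ltnS ltn_ord andbT.
Qed.

Lemma card_box (P : 'I_d -> simpl_pred 'I_L) :
  #|[pred x : site d L | [forall k, P k (x k)]]| = (\prod_k #|P k|)%N.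
Proof.
transitivity #|family P|; first by apply: eq_card => x; rewrite !inE.
by rewrite card_family foldrE big_map big_enum.
Qed.

End counting.

Lemma card_has_succ d l (mu : 'I_d) :
  #|[pred x : site d l.+1 | has_succ x mu]| =
  (\prod_(k < d) if k == mu then l else l.+1)%N.
Proof.
pose P (k : 'I_d) : simpl_pred 'I_l.+1 :=
  if k == mu then [pred i : 'I_l.+1 | (i.+1 < l.+1)%N] else predT.
transitivity #|[pred x : site d l.+1 | [forall k, P k (x k)]]|.
  apply: eq_card => x; rewrite !inE; apply/idP/forallP => [xs k|/(_ mu)].
    by rewrite /P; case: eqP => [->|].
  by rewrite /P eqxx.
rewrite (card_box P) /P; apply: eq_bigr => k _.
case: eqP => _; first exact: card_ord_succ.
by rewrite cardT size_enum_ord.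
Qed.

(** The starting points form a box: coordinates before [mu] vanish, the one along [mu] has a
    successor, the later ones are free. *)
Lemma card_tree_bond d l (mu : 'I_d) :
  #|[pred x : site d l.+1 | tree_bond (x, mu)]| =
  (\prod_(k < d) if k < mu then 1 else if k == mu then l else l.+1)%N.
Proof.
pose P (k : 'I_d) : simpl_pred 'I_l.+1 :=
  if (k < mu)%N then [pred i : 'I_l.+1 | i == 0%N :> nat] else
  if k == mu then [pred i : 'I_l.+1 | (i.+1 < l.+1)%N] else predT.
transitivity #|[pred x : site d l.+1 | [forall k, P k (x k)]]|.
  apply: eq_card => x; rewrite !inE /tree_bond /=.
  apply/andP/forallP => [[xs /low_zeroP z] k|z].
    by rewrite /P; case: ifP => [/z/eqP//|_]; case: eqP => [->|].
  split; first by have := z mu; rewrite /P ltnn eqxx.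
  by apply/low_zeroP => k km; have := z k; rewrite /P km => /eqP.
rewrite (card_box P) /P; apply: eq_bigr => k _.
case: ifP => _; first exact: card_ord_eq0.
case: eqP => _; first exact: card_ord_succ.
by rewrite cardT size_enum_ord.
Qed.

(** Retained bonds and tree bonds partition the free bonds; the additive form avoids truncated
    subtraction. *)
Lemma card_retained_Free d l :
  (#|[pred b : site d l.+1 * 'I_d | retained Free b]| +
   \sum_(mu < d) \prod_(k < d) if k < mu then 1 else if k == mu then l else l.+1)%N =
  (\sum_(mu < d) \prod_(k < d) if k == mu then l else l.+1)%N.
Proof.
under eq_bigr => mu _ do rewrite -card_tree_bond.
under [RHS]eq_bigr => mu _ do rewrite -card_has_succ.
rewrite card_site_dir -big_split; apply: eq_bigr => mu _ /=.
rewrite addnC -(cardID [pred x | tree_bond (x, mu)] [pred x | has_succ x mu]).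
congr addn; apply: eq_card => x; rewrite !inE.
- by rewrite /tree_bond /= [RHS]andbC; case: has_succ; rewrite /= ?andbT.
- by rewrite /retained /= [RHS]andbC.
Qed.

Lemma card_retained_Periodic d l :
  (#|[pred b : site d l.+1 * 'I_d | retained Periodic b]| +
   \sum_(mu < d) \prod_(k < d) if k < mu then 1 else if k == mu then l else l.+1)%N =
  (d * l.+1 ^ d)%N.
Proof.
under eq_bigr => mu _ do rewrite -card_tree_bond.
rewrite card_site_dir -big_split /= -[in RHS](card_ord d) -sum_nat_const.
apply: eq_bigr => mu _ /=.
transitivity #|{: site d l.+1}|; last by rewrite card_ffun !card_ord.
rewrite addnC -(cardID [pred x | tree_bond (x, mu)] predT).
by congr addn; apply: eq_card => x; rewrite !inE ?andbT.
Qed.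

Lemma retained_bondsE d L : (0 < L)%N -> d \in [:: 2; 3; 4]%N ->
  #|[pred b : site d L * 'I_d | retained Free b]| = retained_bonds d L.
Proof.
case: L => // l _; rewrite !inE => /or3P[] /eqP ->;
  [have := card_retained_Free 2 l|have := card_retained_Free 3 l
  |have := card_retained_Free 4 l];
  rewrite /retained_bonds !big_ord_recl !big_ord0 /=;
  move: #|_| => n; rewrite !expnS expn0 !subn1 /=.
- lia.
- lia.
(* Expanding the first factor in l = L - 1 removes its truncated subtractions. *)
- have -> : ((3 * (l.+1 * (l.+1 * (l.+1 * 1))) - l.+1 * (l.+1 * 1) - l.+1).-1 =
    3 * (l * (l * l)) + 8 * (l * l) + 6 * l)%N by lia.
  lia.
Qed.

(** Both boundary conditions share the same tree, so the counts differ by d L^d - d L^(d-1) (L - 1)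
    = d L^(d-1). *)
Lemma retained_extra_bondsE d L : (0 < L)%N -> d \in [:: 2; 3; 4]%N ->
  #|[pred b : site d L * 'I_d | retained Periodic b]| =
  (retained_bonds d L + extra_bonds d L)%N.
Proof.
move=> L0 dd; rewrite -retained_bondsE//.
case: L L0 => // l _; rewrite /extra_bonds.
move: dd; rewrite !inE => /or3P[] /eqP ->;
  [have := card_retained_Free 2 l; have := card_retained_Periodic 2 l
  |have := card_retained_Free 3 l; have := card_retained_Periodic 3 l
  |have := card_retained_Free 4 l; have := card_retained_Periodic 4 l];
  rewrite !big_ord_recl !big_ord0 /=;
  move: #|_| #|_| => n m; rewrite !expnS expn0; lia.
Qed.

(** * Gauge fixing *)

Section gauge.
Context {R : realType} {N d L : nat} {B : boundary}.
Local Notation C := R[i].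
Local Notation config := (config R N d L B).
Implicit Types (U : config) (x : site d L) (mu nu : 'I_d) (b : site d L * 'I_d).

Lemma bond_var_update U (c : bond d L B) (v : borelU R N) b :
  bond_var (update (enum_rank c) v U) b =
  if b == \val c then \val (v : unitary R N) else bond_var U b.
Proof.
rewrite /bond_var; case: insubP => [c' _ <-|nb].
  by rewrite tnth_mktuple (inj_eq enum_rank_inj) val_eqE; case: eqP.
by case: eqP => // bc; move: nb; rewrite bc (valP c).
Qed.

Lemma bond_var_unitary U b : bond_var U b \is unitarymx.
Proof.
by rewrite /bond_var; case: insubP => [c _ _|_];
  [exact: unitary_is_unitarymx|exact: unitarymx1].
Qed.

Lemma mx_measurable_bond_var b : mx_measurable (fun U : config => bond_var U b).
Proof.
rewrite /bond_var; case: insubP => [c _ _|_]; last exact: mx_measurable_cst.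
move=> i j; have [mRe mIm] := @mx_measurable_val R N i j.
split.
- exact: (measurableT_comp mRe (measurable_tnth (enum_rank c))).
- exact: (measurableT_comp mIm (measurable_tnth (enum_rank c))).
Qed.

Lemma plaquette_var_unitary U p : plaquette_var U p \is unitarymx.
Proof.
case: p => [[x mu] nu] /=; apply: mul_unitarymx; last first.
  by rewrite trmxC_unitary bond_var_unitary.
apply: mul_unitarymx; last by rewrite trmxC_unitary bond_var_unitary.
by apply: mul_unitarymx; exact: bond_var_unitary.
Qed.

Lemma mx_measurable_plaquette_var p :
  mx_measurable (fun U : config => plaquette_var U p).
Proof.
case: p => [[x mu] nu] /=; apply: mx_measurable_mul; last first.
  exact/mx_measurable_adj/mx_measurable_bond_var.
apply: mx_measurable_mul; last exact/mx_measurable_adj/mx_measurable_bond_var.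
by apply: mx_measurable_mul; exact: mx_measurable_bond_var.
Qed.

(** Descends the tree path from [x]; [n] is fuel, for which [height x] is the exact amount. *)
Fixpoint gauge_rec U n x : 'M[C]_N :=
  if n is n'.+1 then
    if lead x is Some nu then
      gauge_rec U n' (unshift x nu) *m bond_var U (unshift x nu, nu)
    else 1%:M
  else 1%:M.

(* The product of the bond variables along the tree path from the origin to x. *)
Definition gauge U x := gauge_rec U (height x) x.

Definition gauged U b := gauge U b.1 *m bond_var U b *m (gauge U (shift b.1 b.2))^t*.

Lemma gauge_unitary U x : gauge U x \is unitarymx.
Proof.
rewrite /gauge; move: (height x) => n.
elim: n x => [|n IH] x /=; first exact: unitarymx1.
case: lead => [nu|]; last exact: unitarymx1.
by apply: mul_unitarymx; [exact: IH|exact: bond_var_unitary].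
Qed.

Lemma mx_measurable_gauge x : mx_measurable (fun U : config => gauge U x).
Proof.
rewrite /gauge; move: (height x) => n.
elim: n x => [|n IH] x /=; first exact: mx_measurable_cst.
case: lead => [nu|]; last exact: mx_measurable_cst.
by apply: mx_measurable_mul; [exact: IH|exact: mx_measurable_bond_var].
Qed.

Lemma mx_measurable_gauged b : mx_measurable (fun U : config => gauged U b).
Proof.
apply: mx_measurable_mul; last exact/mx_measurable_adj/mx_measurable_gauge.
by apply: mx_measurable_mul; [exact: mx_measurable_gauge|exact: mx_measurable_bond_var].
Qed.

(** Path products involve tree bonds only. *)
Lemma gauge_update U (c : bond d L B) (v : borelU R N) x : ~~ tree_bond (\val c) ->
  gauge (update (enum_rank c) v U) x = gauge U x.
Proof.
move=> cT; rewrite /gauge; move: (height x) => n; elim: n x => [//|n IH] x /=.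
case xnu : (lead x) => [nu|//]; rewrite IH bond_var_update.
case: eqP => // xc; move: cT.
by rewrite -xc (lead_tree_bond xnu).
Qed.

(** The tree path to the end of [b] is the path to its start followed by [b]. *)
Lemma gauged_tree U b : tree_bond b -> gauged U b = 1%:M.
Proof.
case: b => x mu xT; rewrite /gauged /=.
have -> : gauge U (shift x mu) = gauge U x *m bond_var U (x, mu).
  have /andP[xs _] := xT.
  by rewrite {1}/gauge height_shift//= (tree_bond_lead xT) unshift_shift.
have := unitarymxP (mul_unitarymx (gauge_unitary U x) (bond_var_unitary U (x, mu))).
by [].
Qed.

Lemma gauged_unitary U b : gauged U b \is unitarymx.
Proof.
apply: mul_unitarymx; last by rewrite trmxC_unitary gauge_unitary.
by apply: mul_unitarymx; [exact: gauge_unitary|exact: bond_var_unitary].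
Qed.

(** Gauge factors cancel at the three vertices other than [x]. *)
Lemma plaquette_var_gauged U x mu nu :
  gauge U x *m plaquette_var U (x, mu, nu) *m (gauge U x)^t* =
  gauged U (x, mu) *m gauged U (shift x mu, nu) *m (gauged U (shift x nu, mu))^t*
  *m (gauged U (x, nu))^t*.
Proof.
have uK y (M : 'M[C]_N) : M *m (gauge U y)^t* *m gauge U y = M.
  by rewrite -mulmxA unitarymxKl ?gauge_unitary// mulmx1.
rewrite /gauged /= !trmx_mul !map_mxM !trmxCK (shiftC x nu mu) !mulmxA.
by rewrite !uK.
Qed.

Lemma hs2_conj n (G M : 'M[C]_n) : G \is unitarymx -> hs2 (G *m M *m G^t* ) = hs2 M.
Proof.
move=> uG; rewrite hs2_mulmx_unitary ?trmxC_unitary// /hs2 trmx_mul map_mxM.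
by rewrite -mulmxA (mulmxA (G^t* )) unitarymxKl// mul1mx.
Qed.

Lemma plaquette_action_gauged U x mu nu : plaquette_action U (x, mu, nu) <=
  4 * (hs2 (gauged U (x, mu) - 1%:M) + hs2 (gauged U (shift x mu, nu) - 1%:M) +
       hs2 (gauged U (shift x nu, mu) - 1%:M) + hs2 (gauged U (x, nu) - 1%:M)).
Proof.
rewrite -[leLHS]/(hs2 (plaquette_var U (x, mu, nu) - 1%:M)).
rewrite -(hs2_conj _ (gauge_unitary U x)) mulmxBr mulmxBl mulmx1.
rewrite (unitarymxP (gauge_unitary U x)) plaquette_var_gauged.
by apply: hs2_plaquette; exact: gauged_unitary.
Qed.

Lemma plaquette_actionE U p :
  plaquette_action U p = 2 * complex.Re (\tr (1%:M - plaquette_var U p)).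
Proof. exact/hs2_unitary_sub1/plaquette_var_unitary. Qed.

End gauge.

Section double_sums.
(** Each direction lies in [d.-1] unordered pairs: after exchanging the sums in the second summand,
    the conditions mu < nu and nu < mu merge into nu != mu. *)
Lemma sum_ord_lt (V : nmodType) d (W : 'I_d -> V) :
  \sum_(mu < d) \sum_(nu < d | (mu < nu)%N) (W mu + W nu) = \sum_(mu < d) W mu *+ d.-1.
Proof.
under eq_bigr => mu _ do rewrite big_split.
rewrite big_split /= [X in _ + X](exchange_big_dep xpredT) //= -big_split.
apply: eq_bigr => mu _ /=.
transitivity (\sum_(nu < d | nu != mu) W mu).
  rewrite [RHS](bigID (fun nu : 'I_d => (mu < nu)%N)) /=.
  by congr (_ + _); apply: eq_bigl => nu; rewrite -val_eqE /=; case: ltngtP.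
by rewrite sumr_const cardC1 card_ord.
Qed.
End double_sums.

(** * The action in terms of gauge-fixed bond variables *)

Section action_bounds.
Context {R : realType} {N d L : nat} {B : boundary}.
Local Notation C := R[i].
Local Notation config := (config R N d L B).
Implicit Types (U : config) (x : site d L) (mu nu : 'I_d) (b : site d L * 'I_d).

Lemma hs20 n : hs2 (0 : 'M[C]_n) = 0.
Proof. by rewrite /hs2 mulmx0 mxtrace0. Qed.

Lemma plaquette_bonds x mu nu : is_plaquette B (x, mu, nu) ->
  [/\ is_bond B (x, mu), is_bond B (shift x mu, nu), is_bond B (shift x nu, mu) &
      is_bond B (x, nu)].
Proof.
case: B => //= /andP[mn /andP[xmu xnu]]; split=> //.
- by rewrite /has_succ ffunE -val_eqE gtn_eqF.
- by rewrite /has_succ ffunE -val_eqE ltn_eqF.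
Qed.

Lemma sum_shift (w : site d L * 'I_d -> R) mu nu :
  \sum_x w (shift x mu, nu) = \sum_x w (x, nu).
Proof. by rewrite [RHS](reindex _ (onW_bij _ (shift_bij L mu))). Qed.

(** Periodic shifts permute the sites, so parallel sides of a plaquette contribute equal sums; hence
    8 = 2 * 4. *)
Lemma sum_plaquette (w : site d L * 'I_d -> R) mu nu :
  \sum_x 4 * (w (x, mu) + w (shift x mu, nu) + w (shift x nu, mu) + w (x, nu)) =
  8 * ((\sum_x w (x, mu)) + \sum_x w (x, nu)).
Proof.
rewrite -mulr_sumr 3!big_split /= (sum_shift w mu nu) (sum_shift w nu mu).
by set a := \sum_x w (x, mu); set c := \sum_x w (x, nu); ring.
Qed.

Lemma action_gauged_le U :
  action U <= 8 * d.-1%:R * \sum_(b | retained B b) hs2 (gauged U b - 1%:M).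
Proof.
(* Extension by zero lets the sums run over all sites and directions for either boundary condition.
   On tree bonds zero is the true value, by [gauged_tree]. *)
pose w b := if retained B b then hs2 (gauged U b - 1%:M) else 0.
have w0 b : 0 <= w b by rewrite /w; case: ifP => // _; exact: hs2_ge0.
have wE b : is_bond B b -> hs2 (gauged U b - 1%:M) = w b.
  rewrite /w /retained => -> /=; case: (boolP (tree_bond b)) => //= bT.
  by rewrite gauged_tree// subrr hs20.
pose f x mu nu := 4 * (w (x, mu) + w (shift x mu, nu) + w (shift x nu, mu) + w (x, nu)).
have f0 x mu nu : 0 <= f x mu nu by rewrite mulr_ge0// !addr_ge0.
(* Enlarge the sum to all periodic plaquettes, which the nonnegativity of [f] allows. *)
apply: (@le_trans _ _ (\sum_(p : site d L * 'I_d * 'I_d | (p.1.2 < p.2)%N)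
    f p.1.1 p.1.2 p.2)).
  rewrite /action big_mkcond [leRHS]big_mkcond; apply: ler_sum => -[[x mu] nu] _ /=.
  case: ifP => [pl|_]; last by case: ifP.
  have -> : (mu < nu)%N by move: pl => /= /andP[].
  have [b1 b2 b3 b4] := plaquette_bonds pl.
  by rewrite /f -!wE//; exact: plaquette_action_gauged.
rewrite -(pair_big_dep xpredT (fun (q : site d L * 'I_d) nu => (q.2 < nu)%N)
  (fun q nu => f q.1 q.2 nu)) /=.
rewrite -(pair_bigA _ (fun x mu => \sum_(nu < d | (mu < nu)%N) f x mu nu)) /=.
rewrite exchange_big /=; under eq_bigr => mu _ do rewrite exchange_big /=.
have fE mu nu : \sum_x f x mu nu = 8 * ((\sum_x w (x, mu)) + \sum_x w (x, nu)).
  exact: sum_plaquette.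
under eq_bigr => mu _ do under eq_bigr => nu _ do rewrite fE.
under eq_bigr => mu _ do rewrite -mulr_sumr.
rewrite -mulr_sumr (sum_ord_lt (fun mu => \sum_x w (x, mu))) -mulrA ler_pM2l//.
rewrite sumrMnl mulr_natl ler_wMn2r// exchange_big /=.
rewrite (pair_bigA _ (fun x mu => w (x, mu))) /= [leRHS]big_mkcond.
by apply: ler_sum => -[x mu] _.
Qed.

Lemma boltzmann_le1 k n (M : 'M[C]_n) : 0 <= k -> M \is unitarymx -> boltzmann k M <= 1.
Proof.
move=> k0 uM; rewrite /boltzmann expR_le1 oppr_le0 mulr_ge0//.
by have := hs2_ge0 (M - 1%:M); rewrite hs2_unitary_sub1//; lra.
Qed.

Lemma expR_action k U : expR (- (k * action U)) =
  \prod_(p | is_plaquette B p) boltzmann (2 * k) (plaquette_var U p).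
Proof.
rewrite /action mulr_sumr -sumrN expR_sum; apply: eq_bigr => p _.
by rewrite /boltzmann plaquette_actionE; congr (expR (- _)); ring.
Qed.

Lemma measurable_expR_action k :
  measurable_fun setT (fun U : config => expR (- (k * action U))).
Proof.
under eq_fun => U do rewrite expR_action -big_filter.
apply: measurable_prod => p _.
by apply: measurable_boltzmann; exact: mx_measurable_plaquette_var.
Qed.

(** The constant 16 is the 8 of [action_gauged_le] times the 2 of [hs2_unitary_sub1]. *)
Lemma expR_action_ge k U : 0 <= k ->
  \prod_(b | retained B b) boltzmann (16 * k * d.-1%:R) (gauged U b) <=
  expR (- (k * action U)).
Proof.
move=> k0; rewrite /boltzmann -expR_sum ler_expR sumrN lerN2.
apply: (le_trans (ler_wpM2l k0 (action_gauged_le U))).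
rewrite mulr_sumr mulr_sumr; apply: ler_sum => b _.
rewrite hs2_unitary_sub1 ?gauged_unitary// le_eqVlt; apply/orP; left.
by apply/eqP; ring.
Qed.

Definition bond_of (i : 'I_#|{: bond d L B}|) : site d L * 'I_d := \val (enum_val i).

Definition retained_ord : {set 'I_#|{: bond d L B}|} :=
  [set i | retained B (bond_of i)]%SET.

Lemma bond_of_inj : injective bond_of.
Proof. by move=> i j /val_inj/enum_val_inj. Qed.

Lemma bond_of_retained :
  [set bond_of i | i in retained_ord]%SET = [set b | retained B b]%SET.
Proof.
apply/setP => b; rewrite inE; apply/imsetP/idP => [[i + ->]|bR]; first by rewrite inE.
have bB : is_bond B b by case/andP: bR.
exists (enum_rank (Sub b bB : bond d L B)); last by rewrite /bond_of enum_rankK.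
by rewrite inE /bond_of enum_rankK.
Qed.

Lemma card_retained_ord :
  #|retained_ord| = #|[pred b : site d L * 'I_d | retained B b]|.
Proof.
rewrite -(card_imset _ bond_of_inj) bond_of_retained.
by apply: eq_card => b; rewrite !inE.
Qed.

Lemma prod_retained_ord (f : site d L * 'I_d -> R) :
  \prod_(i in retained_ord) f (bond_of i) = \prod_(b | retained B b) f b.
Proof.
rewrite -(big_imset f) /=; last by move=> i j _ _; exact: bond_of_inj.
by rewrite bond_of_retained; apply: eq_bigl => b; rewrite inE.
Qed.

End action_bounds.

(** * Bounds on the partition functions *)

Section partition_bounds.
Context {R : realType} {N d L : nat} (sigma : probability (borelU R N) R).
Context (haar : is_haar sigma).
Local Notation C := R[i].
Implicit Types (x : site d L) (mu nu : 'I_d) (b : site d L * 'I_d).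

(** At [k = 2 * coupling d a g] this unfolds to [z_upper]. *)
Definition boltzmann_integral (k : R) : \bar R :=
  (\int[sigma]_U (boltzmann k (\val (U : unitary R N)))%:E)%E.

Lemma gauged_update B (U : config R N d L B) (c : bond d L B) (v : borelU R N) b :
  ~~ tree_bond (\val c) ->
  gauged (update (enum_rank c) v U) b =
  if b == \val c then
    gauge U b.1 *m \val (v : unitary R N) *m (gauge U (shift b.1 b.2))^t*
  else gauged U b.
Proof.
move=> cT; rewrite /gauged !gauge_update// bond_var_update.
by case: eqP.
Qed.

Lemma partition_function_ge B (a g : R) : 0 <= coupling d a g ->
  (boltzmann_integral (16 * coupling d a g * d.-1%:R) ^+
     #|[pred b : site d L * 'I_d | retained B b]| <=
   partition_function d L sigma B a g)%E.
Proof.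
move=> k0; set k := 16 * _ * _.
pose F (i : 'I_#|{: bond d L B}|) (U : config R N d L B) :=
  boltzmann k (gauged U (bond_of i)).
have mF i : measurable_fun setT (F i).
  by apply: measurable_boltzmann; exact: mx_measurable_gauged.
have F0 i U : 0 <= F i U by exact: boltzmann_ge0.
have nT (i : 'I_#|{: bond d L B}|) : i \in retained_ord ->
    ~~ tree_bond (\val (enum_val i : bond d L B)).
  by rewrite inE => /andP[].
rewrite -card_retained_ord.
(* A constant rank suffices: each factor depends on a single retained bond besides the tree
   bonds. *)
rewrite -(@ge0_integral_power_prod _ _ _ sigma _ F (fun=> 0%N) _ retained_ord mF F0).
- apply: ge0_le_integral => //.
  + by move=> U _; rewrite lee_fin prodr_ge0.
  + apply/measurable_EFinP.
    by under eq_fun => U do rewrite -big_enum; exact: measurable_prod.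
  + by apply/measurable_EFinP; exact: measurable_expR_action.
  + move=> U _; rewrite lee_fin (prod_retained_ord (fun b => boltzmann k (gauged U b))).
    exact: expR_action_ge.
- move=> i U iS; pose b := bond_of i.
  rewrite /boltzmann_integral -(ge0_integral_haar_boltzmann (A := gauge U b.1)
    (B := (gauge U (shift b.1 b.2))^t* ) k haar); last 2 first.
  + exact: gauge_unitary.
  + by rewrite trmxC_unitary gauge_unitary.
  apply: eq_integral => v _; rewrite /F -{1}(enum_valK i) gauged_update ?nT//.
  by rewrite -[\val (enum_val i)]/b eqxx.
- move=> i j v U iS jS ij _; rewrite -(enum_valK j) /F gauged_update ?nT//.
  by rewrite -[\val (enum_val j)]/(bond_of j) (inj_eq bond_of_inj) (negPf ij).
Qed.

Lemma prod_le_subset (I : finType) (A D : pred I) (f : I -> R) :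
  (forall i, A i -> D i) -> (forall i, 0 <= f i <= 1) ->
  \prod_(i | D i) f i <= \prod_(i | A i) f i.
Proof.
move=> AD f01; rewrite (bigID A) /=.
rewrite (eq_bigl A); last first.
  by move=> i /=; rewrite andbC; case: (boolP (A i)) => // /AD ->.
apply: ler_piMr; first by apply: prodr_ge0 => i _; have /andP[] := f01 i.
by apply: prodr_ile1 => i _; exact: f01.
Qed.

Lemma partition_function_Free_le (a g : R) : 0 <= coupling d a g ->
  (partition_function d L sigma Free a g <=
   boltzmann_integral (2 * coupling d a g) ^+
     #|[pred b : site d L * 'I_d | retained Free b]|)%E.
Proof.
move=> k0; set k := 2 * coupling d a g.
have kk0 : 0 <= k by rewrite mulr_ge0.
pose F (i : 'I_#|{: bond d L Free}|) (U : config R N d L Free) :=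
  boltzmann k (plaquette_var U (lead_plaquette (bond_of i))).
have mF i : measurable_fun setT (F i).
  by apply: measurable_boltzmann; exact: mx_measurable_plaquette_var.
have F0 i U : 0 <= F i U by exact: boltzmann_ge0.
have leadS (i : 'I_#|{: bond d L Free}|) : i \in retained_ord ->
    exists x nu mu, [/\ bond_of i = (x, mu), lead x = Some nu & (nu < mu)%N].
  rewrite inE; case: (bond_of i) => x mu /andP[/= xs]; rewrite /tree_bond /= xs /=.
  by move=> /lead_not_low[nu [xnu nm]]; exists x, nu, mu.
rewrite -card_retained_ord.
rewrite -(@ge0_integral_power_prod _ _ _ sigma _ F (fun i => bond_rank (bond_of i))
  _ retained_ord mF F0).
- apply: ge0_le_integral => //.
  + by apply/measurable_EFinP; exact: measurable_expR_action.
  + apply/measurable_EFinP.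
    by under eq_fun => U do rewrite -big_enum; exact: measurable_prod.
  + move=> U _; rewrite lee_fin expR_action -/k.
    pose w b := boltzmann k (plaquette_var U (lead_plaquette b)).
    rewrite (prod_retained_ord w).
    (* Reindexed by distinct plaquettes, the product omits only factors at most 1 of the full
       weight. *)
    have -> : \prod_(b | retained Free b) w b =
        \prod_(p in [set lead_plaquette b | b in [pred b | retained Free b]]%SET)
          boltzmann k (plaquette_var U p).
      by rewrite big_imset//=; exact: lead_plaquette_inj.
    apply: prod_le_subset => [p /imsetP[b bR ->]|p]; first exact: lead_plaquetteP.
    by rewrite boltzmann_ge0 boltzmann_le1 ?plaquette_var_unitary.
- move=> i U iS; have [x [nu [mu [iE xnu nm]]]] := leadS i iS.
  have /andP[x0 _] : (x nu != 0%N :> nat) && low_zero x nu by rewrite -leadP xnu.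
  (* The other three bonds of the plaquette have smaller rank: two point along nu < mu, the third is
     parallel to (x, mu) but starts one unit lower. *)
  have neq b : (bond_rank b < bond_rank (x, mu))%N -> (b == (x, mu)) = false.
    by apply: contraTF => /eqP ->; rewrite ltnn.
  (* In p_{nu mu}(x - e^nu) the bond (x, mu) is the second factor; [A] is the first and [A'] the
     product of the last two. *)
  pose A := bond_var U (unshift x nu, nu).
  pose A' :=
    (bond_var U (shift (unshift x nu) mu, nu))^t* *m (bond_var U (unshift x nu, mu))^t*.
  rewrite -[RHS](ge0_integral_haar_boltzmann (A := A) (B := A') k haar); last 2 first.
  + exact: bond_var_unitary.
  + by apply: mul_unitarymx; rewrite trmxC_unitary bond_var_unitary.
  apply: eq_integral => v _; rewrite /F -{1}(enum_valK i) iE.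
  rewrite /lead_plaquette /= xnu /= !bond_var_update.
  rewrite -[\val (enum_val i)]/(bond_of i) iE shift_unshift eqxx.
  rewrite (neq _ (bond_rank_dir _ _ nm)) (neq _ (bond_rank_dir _ _ nm)).
  by rewrite (neq _ (bond_rank_unshift _ x0)) /A /A' !mulmxA.
- move=> i j v U iS jS ij rij; have [x [nu [mu [iE xnu nm]]]] := leadS i iS.
  have /andP[x0 _] : (x nu != 0%N :> nat) && low_zero x nu by rewrite -leadP xnu.
  (* Bond j ranks at least as high as bond i, so it is none of the three lower bonds of the
     plaquette of i. *)
  have neq b : (bond_rank b < bond_rank (x, mu))%N -> (b == bond_of j) = false.
    apply: contraTF => /eqP ->; rewrite -leqNgt.
    by rewrite -iE.
  have neqi : ((x, mu) == bond_of j) = false.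
    by rewrite -iE (inj_eq bond_of_inj) (negPf ij).
  rewrite -(enum_valK j) /F iE /lead_plaquette /= xnu /= !bond_var_update.
  rewrite -[\val (enum_val j)]/(bond_of j) shift_unshift neqi.
  rewrite (neq _ (bond_rank_dir _ _ nm)) (neq _ (bond_rank_dir _ _ nm)).
  by rewrite (neq _ (bond_rank_unshift _ x0)).
Qed.

Definition periodic_of_free (b : bond d L Free) : bond d L Periodic :=
  Sub (\val b) isT.

Definition free_ord (i : 'I_#|{: bond d L Free}|) : 'I_#|{: bond d L Periodic}| :=
  enum_rank (periodic_of_free (enum_val i)).

Lemma free_ord_inj : injective free_ord.
Proof. by move=> i j /enum_rank_inj [] /val_inj /enum_val_inj. Qed.

Definition free_part (U : config R N d L Periodic) : config R N d L Free :=
  pullback free_ord U.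

Lemma bond_var_free_part (U : config R N d L Periodic) b : is_bond Free b ->
  bond_var (free_part U) b = bond_var U b.
Proof.
move=> bF; rewrite /bond_var (insubT (is_bond Free) bF).
rewrite (insubT (is_bond Periodic) (isT : is_bond Periodic b)).
by rewrite tnth_mktuple /free_ord enum_rankK; congr (\val (tnth U (enum_rank _))).
Qed.

Lemma expR_action_free_part k (U : config R N d L Periodic) : 0 <= k ->
  expR (- (k * action U)) <= expR (- (k * action (free_part U))).
Proof.
move=> k0; rewrite [leLHS]expR_action [leRHS]expR_action.
rewrite [leRHS](eq_bigr (fun p => boltzmann (2 * k) (plaquette_var U p))); last first.
  move=> [[x mu] nu] /plaquette_bonds[b1 b2 b3 b4]; congr boltzmann.
  by rewrite /plaquette_var !bond_var_free_part.
apply: prod_le_subset => [[[x mu] nu] /= /andP[-> _]//|p].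
by rewrite boltzmann_ge0 boltzmann_le1 ?plaquette_var_unitary// mulr_ge0.
Qed.

Lemma partition_function_Periodic_le (a g : R) : 0 <= coupling d a g ->
  (partition_function d L sigma Periodic a g <=
   partition_function d L sigma Free a g)%E.
Proof.
move=> k0.
pose E (U : config R N d L Free) : \bar R := (expR (- (coupling d a g * action U)))%:E.
have mE : measurable_fun setT E.
  by apply/measurable_EFinP; exact: measurable_expR_action.
have E0 U : (0 <= E U)%E by rewrite lee_fin expR_ge0.
rewrite /partition_function -[leRHS]/(\int[_]_U E U)%E.
(* The free bonds of a periodic configuration are distributed as a free configuration, so both sides
   become integrals over periodic configurations. *)
rewrite -(ge0_integral_pullback sigma free_ord_inj mE E0).
apply: ge0_le_integral; first exact: measurableT.
- by move=> U _; rewrite lee_fin expR_ge0.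
- by apply/measurable_EFinP; exact: measurable_expR_action.
- exact: (measurableT_comp mE (measurable_pullback free_ord)).
- by move=> U _; rewrite lee_fin; exact: expR_action_free_part.
Qed.

(* The integral is a supremum of integrals of simple functions, hence monotone
   without measurability: the integrand of z_lower is not known to be measurable. *)
Lemma le_integral_nonmeasurable d' (X : measurableType d')
    (mu : {measure set X -> \bar R}) (f1 f2 : X -> \bar R) :
  (forall t, 0 <= f1 t)%E -> (forall t, f1 t <= f2 t)%E ->
  (\int[mu]_t f1 t <= \int[mu]_t f2 t)%E.
Proof.
move=> f10 f12; have f20 t : (0 <= f2 t)%E by exact: le_trans (f12 t).
rewrite !ge0_integralTE//; apply: ereal_sup_le => _ [h hf1 <-].
by exists h => // t; exact: le_trans (f12 t).
Qed.

Lemma z_lower_ge0 (C' a g : R) : (0 <= z_lower d sigma C' a g)%E.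
Proof. by apply: integral_ge0 => U _; rewrite lee_fin expR_ge0. Qed.

(** For U = e^(iX), 2 C'^2 tr X^2 >= 8 tr X^2 >= 16 Re tr (1 - U), the last step by
    [log_unitary_bound]. *)
Lemma z_lower_le (C' a g : R) : (0 < d)%N -> 0 <= coupling d a g -> 4 <= C' ^+ 2 ->
  (z_lower d sigma C' a g <= boltzmann_integral (16 * coupling d a g * d.-1%:R))%E.
Proof.
move=> d0 k0 C4; apply: le_integral_nonmeasurable => U; rewrite lee_fin ?expR_ge0//.
rewrite /boltzmann ler_expR lerN2.
have := log_unitary_bound U; have := hs2_ge0 (\val (U : unitary R N) - 1%:M).
rewrite hs2_unitary_sub1 ?unitary_is_unitarymx//.
move: (complex.Re _) (complex.Re _) => l t t0 tl.
have -> : d%:R - 1 = d.-1%:R :> R by rewrite -subn1 natrB.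
move: (coupling d a g) (C' ^+ 2) k0 C4 => k c k0 c4.
have -> : 16 * k * d.-1%:R * t = k * d.-1%:R * (16 * t) by ring.
have -> : 2 * c * k * d.-1%:R * l = k * d.-1%:R * (2 * (c * l)) by ring.
rewrite ler_wpM2l ?mulr_ge0//.
have : 0 <= (c - 4) * l by rewrite mulr_ge0; lra.
lra.
Qed.

Lemma expe_le (x y : \bar R) n : (0 <= x)%E -> (x <= y)%E -> (x ^+ n <= y ^+ n)%E.
Proof.
move=> x0 xy; elim: n => [//|n IH]; rewrite !expeS.
by apply: lee_pmul => //; exact: expe_ge0.
Qed.

End partition_bounds.

Theorem theorem1 (R : realType) (N L d : nat) (a g g0 C : R)
  (sigma : probability (borelU R N) R) :
  (0 < N)%N -> (0 < L)%N -> d \in [:: 2; 3; 4]%N ->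
  0 < a <= 1 -> 0 < g0 -> 0 < g ^+ 2 <= g0 ^+ 2 -> C ^+ 2 = 4 * N%:R ->
  is_haar sigma ->
  let Z := partition_function d L sigma Free a g in
  let ZP := partition_function d L sigma Periodic a g in
  let zu := z_upper d sigma a g in
  let zl := z_lower d sigma C a g in
  let Lr := retained_bonds d L in
  let Le := extra_bonds d L in
  ((zl ^+ Lr <= Z)%E /\ (Z <= zu ^+ Lr)%E) /\
  [/\ (zl ^+ (Lr + Le) <= ZP)%E, (ZP <= Z)%E & (Z <= zu ^+ Lr)%E].
Proof.
move=> N0 L0 dd /andP[a0 _] _ /andP[g20 _] CN haar Z ZP zu zl Lr Le.
have k0 : 0 <= coupling d a g.
  by rewrite /coupling divr_ge0 ?(ltW g20)// exprz_ge0// ltW.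
have d0 : (0 < d)%N by move: dd; rewrite !inE => /or3P[] /eqP ->.
have zl_le : (zl <= boltzmann_integral sigma (16 * coupling d a g * d.-1%:R))%E.
  (* Here C^2 = 4 N >= 4 because N is positive. *)
  by apply: z_lower_le => //; rewrite CN ler_peMr// ler1n.
have zl0 : (0 <= zl)%E by exact: z_lower_ge0.
have upper : (Z <= zu ^+ Lr)%E.
  by rewrite /Lr -retained_bondsE//; exact: partition_function_Free_le.
split; [split=> //|split=> //].
- rewrite /Lr -retained_bondsE//.
  apply: le_trans (partition_function_ge (L := L) haar Free k0).
  exact: expe_le.
- rewrite /Lr /Le -retained_extra_bondsE//.
  apply: le_trans (partition_function_ge (L := L) haar Periodic k0).
  exact: expe_le.
- exact: partition_function_Periodic_le.
Qed.
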